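(* Let $C$ be a curve in an elastic graph $(\Gamma,\alpha)$, and let $f\colon\Gamma\to K$ be a harmonic map to a length graph $(K,\ell)$. Then $$\ell[f_*C]^2\le\operatorname{Dir}[f]\,\operatorname{EL}[C].$$
   Context: A graph is a finite connected 1-complex (multiple edges, self-loops allowed); maps of graphs are continuous and need not take vertices to vertices. An elastic graph $(\Gamma,\alpha)$ has on each edge $e$ a positive measure absolutely continuous with respect to Lebesgue measure, of total mass $\alpha(e)>0$. A length graph $(K,\ell)$ has a non-negative length $\ell(e)$ on each edge (defining a pseudo-metric). A curve on a graph is a map from a closed, not necessarily connected 1-manifold, up to homotopy; $n_C(e)$ is the number of times its taut (non-backtracking) representative runs over $e$; $f_*C$ is the homotopy class of $f\circ C$. $\operatorname{EL}[C]=\sum_{e\in\operatorname{Edge}(\Gamma)}n_C(e)^2\alpha(e)$; for a curve $D$ on $K$, $\ell[D]=\sum_{e\in\operatorname{Edge}(K)}n_D(e)\ell(e)$. For Lipschitz $f\colon\Gamma\to K$, $\operatorname{Dir}(f)=\int_\Gamma|f'(x)|^2dx$, with derivative taken with respect to the coordinates given by $\alpha$ and $\ell$, and $\operatorname{Dir}[f]=\inf_{g\in[f]}\operatorname{Dir}(g)$ over the homotopy class. A map is harmonic if it minimizes $\operatorname{Dir}$ in its homotopy class. *)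

(* Defs.v *)
From HB Require Import structures.
From mathcomp Require Import all_boot all_order all_algebra.
From mathcomp Require Import all_classical all_reals all_analysis.

Set Implicit Arguments.
Unset Strict Implicit.
Unset Printing Implicit Defensive.

Import Order.TTheory GRing.Theory Num.Theory.
Import numFieldNormedType.Exports.

Local Open Scope classical_set_scope.
Local Open Scope ring_scope.

(* Edges carry a reference orientation; it is only used to name their points. *)
Record graph := Graph {
  gvert : finType;
  gedge : finType;
  gsrc : gedge -> gvert;
  gtgt : gedge -> gvert;
  gvert_gt0 : (0 < #|gvert|)%N;
  gconnected : forall u v : gvert,
    connect (fun a b => [exists e, ((gsrc e == a) && (gtgt e == b))
                                || ((gsrc e == b) && (gtgt e == a))]) u v }.

(* The points of the 1-complex: vertices, and interior points of edges. *)
Definition gspace (R : realType) (G : graph) : Type :=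
  (gvert G + gedge G * {t : R | 0 < t < 1})%type.

HB.instance Definition _ (R : realType) (G : graph) :=
  Choice.copy (gspace R G) (gvert G + gedge G * {t : R | 0 < t < 1})%type.

(* The characteristic map [0, 1] -> |G| of the edge e, extended to R by its
   constant values at the ends. *)
Definition chart (R : realType) (G : graph) (e : gedge G) (t : R) :
    gspace R G :=
  match insub t : option {t : R | 0 < t < 1} with
  | Some t' => inr (e, t')
  | None => inl (if t <= 0 then gsrc e else gtgt e)
  end.

(* The topology of the 1-complex. Clamping R onto [0, 1] is a retraction, so
   the preimage under chart is open in R iff its trace is open in [0, 1]. *)
Section GraphTopology.
Context (R : realType) (G : graph).

Definition gspace_open : set_system (gspace R G) :=
  [set U | forall e : gedge G, open (@chart R G e @^-1` U)].

Lemma gspace_openT : gspace_open setT.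
Proof. by move=> e; rewrite preimage_setT; exact: openT. Qed.

Lemma gspace_openI : setI_closed gspace_open.
Proof. by move=> A B oA oB e; rewrite preimage_setI; exact: openI. Qed.

Lemma gspace_open_bigU (I : Type) (f : I -> set (gspace R G)) :
  (forall i, gspace_open (f i)) -> gspace_open (\bigcup_i f i).
Proof.
by move=> of_ e; rewrite preimage_bigcup; apply: bigcup_open => i _; exact: of_.
Qed.

HB.instance Definition _ := isOpenTopological.Build (gspace R G)
  gspace_openT gspace_openI gspace_open_bigU.

End GraphTopology.

(* P constrains every stage of the homotopy. *)
Definition homotopic_through (R : realType) (X Y : topologicalType)
    (P : (X -> Y) -> Prop) (f g : X -> Y) : Prop :=
  exists H : X * R -> Y,
    [/\ {within [set: X] `*` `[0, 1], continuous H},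
        forall s, s \in `[0, 1] -> P (fun x => H (x, s)),
        forall x, H (x, 0) = f x & forall x, H (x, 1) = g x].

Definition homotopic (R : realType) (X Y : topologicalType) (f g : X -> Y) :=
  homotopic_through R (fun=> True) f g.

(* Maps from the circle R/Z are 1-periodic maps on R. *)
Definition periodic1 (R : realType) (Y : Type) (c : R -> Y) : Prop :=
  forall t, c (t + 1) = c t.

(* A closed 1-manifold is a disjoint union of finitely many circles, here
   indexed by 'I_k. *)
Definition is_curve (R : realType) (Y : topologicalType) (k : nat)
    (C : 'I_k -> R -> Y) : Prop :=
  forall i, continuous (C i) /\ periodic1 (C i).

Definition loop_homotopic (R : realType) (Y : topologicalType)
    (c d : R -> Y) : Prop :=
  homotopic_through R (@periodic1 R Y) c d.

(* f_* C; it is a curve whenever C is a curve and f is continuous. *)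
Definition push_curve (R : realType) (X Y : Type) (f : X -> Y) (k : nat)
    (C : 'I_k -> R -> X) : 'I_k -> R -> Y := fun i => f \o C i.

(* (e, true) is e run over from gsrc e to gtgt e, (e, false) its reverse. *)
Definition oedge (G : graph) : Type := (gedge G * bool)%type.

Section TautRepresentatives.
Context (R : realType) (G : graph).

Definition osrc (a : oedge G) := if a.2 then gsrc a.1 else gtgt a.1.
Definition otgt (a : oedge G) := if a.2 then gtgt a.1 else gsrc a.1.
Definition orev (a : oedge G) : oedge G := (a.1, ~~ a.2).

Definition ochart (a : oedge G) (t : R) : gspace R G :=
  chart a.1 (if a.2 then t else 1 - t).

(* A non-backtracking closed edge-path; the condition is cyclic, so that it
   also applies from the last edge to the first one. *)
Definition nonbacktracking (w : seq (gedge G * bool)) : bool :=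
  cycle (fun a b : gedge G * bool => (otgt a == osrc b) && (b != orev a)) w.

(* The loop that runs over the edges of the nonempty word a :: w in turn, at
   constant speed, in one period. *)
Definition edge_loop (a : oedge G) (w : seq (gedge G * bool)) (t : R) :
    gspace R G :=
  let u := (t - (Num.floor t)%:~R) * (size w).+1%:R in
  let j := Num.truncn u in
  ochart (nth a (a :: w) j) (u - j%:R).

(* w spells the taut representative of the loop c; the empty word stands for
   a constant representative. *)
Definition taut_word (c : R -> gspace R G) (w : seq (gedge G * bool)) : Prop :=
  if w is a :: w' then nonbacktracking w /\ loop_homotopic c (edge_loop a w')
  else exists p, loop_homotopic c (fun=> p).

(* n_C(e). Every loop in a graph has a taut word, unique up to cyclic
   rotation, so the default and the choice made by xget are immaterial. *)
Definition ncross (k : nat) (C : 'I_k -> R -> gspace R G) (e : gedge G) : nat :=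
  (\sum_(i < k)
     count (fun a => a.1 == e) (xget [::] [set w | taut_word (C i) w]))%N.

End TautRepresentatives.

(* The measure on the edge e is transported to [0, 1] by chart e; only its
   restriction to [0, 1] is ever used. Positivity means positive mass on every
   nondegenerate subinterval, which is what makes ecoord below a coordinate. *)
Record elastic (R : realType) (G : graph) := Elastic {
  emeas : gedge G -> {measure set (measurableTypeR R) -> \bar R};
  emeas_abs_cont : forall e, emeas e `<< @lebesgue_measure R;
  emeas_fin : forall e, (emeas e (`[0%R, 1%R]%classic : set R) < +oo)%E;
  emeas_pos : forall e (a b : R), 0 <= a -> a < b -> b <= 1 ->
    (0 < emeas e (`[a, b]%classic : set R))%E }.

Record lengths (R : realType) (K : graph) := Lengths {
  elen : gedge K -> R;
  elen_ge0 : forall e, 0 <= elen e }.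

(* alpha(e) *)
Definition emass (R : realType) (G : graph) (al : elastic R G) (e : gedge G) :
    R := fine (emeas al e (`[0, 1]%classic : set R)).

(* The coordinates on edges given by alpha and by l: increasing functions of
   the parameter t in [0, 1] onto [0, alpha(e)], resp. [0, l(e)]. *)
Definition ecoord (R : realType) (G : graph) (al : elastic R G)
    (e : gedge G) (t : R) : R := fine (emeas al e (`[0, t]%classic : set R)).

Definition lcoord (R : realType) (K : graph) (l : lengths R K)
    (e : gedge K) (t : R) : R := elen l e * t.

(* The point of the edge e whose alpha-coordinate is s, for s in
   [0, alpha(e)]. *)
Definition epoint (R : realType) (G : graph) (al : elastic R G)
    (e : gedge G) (s : R) : gspace R G :=
  chart e (xget 0 [set t | t \in `[0, 1] /\ ecoord al e t = s]).

(* The path pseudo-metric for given coordinates u on the edges: the infimum of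
   the lengths of the chains of segments joining two points. (e, s, t) is the
   segment of e from parameter s to parameter t. *)
Section PathMetric.
Context (R : realType) (G : graph) (u : gedge G -> R -> R).

Fixpoint chain (x y : gspace R G) (p : seq (gedge G * R * R)) : Prop :=
  if p is (e, s, t) :: p' then
    [/\ s \in `[0, 1], t \in `[0, 1], x = chart e s & chain (chart e t) y p']
  else x = y.

Definition chain_length (p : seq (gedge G * R * R)) : R :=
  \sum_(a <- p) `|u a.1.1 a.2 - u a.1.1 a.1.2|.

Definition gdist (x y : gspace R G) : R :=
  inf [set chain_length p | p in chain x y].

End PathMetric.

Section Energies.
Context (R : realType) (G K : graph) (al : elastic R G) (l : lengths R K).

Definition glipschitz (f : gspace R G -> gspace R K) : Prop :=
  exists L : R, forall x y,
    gdist (lcoord l) (f x) (f y) <= L * gdist (ecoord al) x y.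

(* The l-coordinate of a point of K in the interior of an edge. *)
Definition lval (y : gspace R K) : R :=
  if y is inr (e, t) then lcoord l e (val t) else 0.

(* The speed of a path p in K. Around a parameter s with p s interior to an
   edge, p stays in that edge and is differentiated in its l-coordinate.
   A Lipschitz path has zero derivative at almost every parameter at which it
   is at a given vertex, whence the second branch. *)
Definition speed (p : R -> gspace R K) (s : R) : R :=
  if p s is inr _ then `| derive1 (lval \o p) s | else 0.

Definition Dir (f : gspace R G -> gspace R K) : \bar R :=
  (\sum_(e : gedge G)
     \int[@lebesgue_measure R]_(s in `[0%R, emass al e])
       ((speed (f \o epoint al e) s) ^+ 2)%:E)%E.

Definition lipschitz_map (f : gspace R G -> gspace R K) : Prop :=
  continuous f /\ glipschitz f.

(* Dir[f] *)
Definition DirClass (f : gspace R G -> gspace R K) : \bar R :=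
  ereal_inf [set Dir g | g in [set g | lipschitz_map g /\ homotopic R f g]].

Definition is_harmonic (f : gspace R G -> gspace R K) : Prop :=
  lipschitz_map f /\
  forall g, lipschitz_map g -> homotopic R f g -> (Dir f <= Dir g)%E.

(* EL[C] *)
Definition EL (k : nat) (C : 'I_k -> R -> gspace R G) : R :=
  \sum_(e : gedge G) (ncross C e)%:R ^+ 2 * emass al e.

(* l[D] *)
Definition curve_length (k : nat) (D : 'I_k -> R -> gspace R K) : R :=
  \sum_(e : gedge K) (ncross D e)%:R * elen l e.

End Energies.

(* Main.v *)
Require Import Defs.
From HB Require Import structures.
From mathcomp Require Import all_boot all_order all_algebra.
From mathcomp Require Import all_classical all_reals all_analysis.
From mathcomp Require Import measurable_realfun.
From mathcomp Require Import ring lra zify.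
Import Order.TTheory GRing.Theory Num.Theory.
Import numFieldNormedType.Exports.

Set Implicit Arguments.
Unset Strict Implicit.
Unset Printing Implicit Defensive.

Local Open Scope classical_set_scope.
Local Open Scope ring_scope.

(* For each edge e of G let V e be the length of the path f o e. Cauchy-Schwarz
   on e gives 2 c V e - c^2 alpha(e) <= the energy of f on e, for all c >= 0;
   with c = lam n_C(e), summation over e and the best choice of lam yield
   (sum_e n_C(e) V e)^2 <= Dir(f) EL[C]. It remains to see that the image under
   f of a taut representative of C, whose length is sum_e n_C(e) V e, is at
   least as long as the taut representative of f_* C. For that, fix a parameter
   th in (0, 1) and record the successive passages of a loop through the points
   of parameter th of the edges of K, as a word in the free group on the edges.
   A homotopy of loops only conjugates this word, and a cyclically reduced word
   uses each letter least often in its conjugacy class. So a loop homotopic to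
   the taut one passes through almost every point at least as often as the taut
   one does, and its length is obtained by averaging over th. *)

(** * Continuity and gluing of real functions *)

(** A loop that is only continuous may pass through a point infinitely often, so passages are never
    counted on the loop itself. It is sampled at the multiples of 1/N, with N so large that
    consecutive samples share a small contractible piece of the graph, and letters are read off
    pairs of consecutive samples. The same samples bound the length from below, because the
    variation of a Lipschitz function along any finite sample is at most the integral of the
    absolute value of its derivative. Length in K is measured through the distance to the nearest
    vertex, a real function on all of K, so that only real Lipschitz functions on intervals have to
    be differentiated. This function folds each edge at its midpoint, hence margins of width [ep]
    are cut off at the ends and around the midpoint; [ep] tends to 0 at the end. Taut words of C
    must be shown to exist, since the default of [xget] would make EL[C] vanish; for f_* C the
    default only gives length 0. *)

Lemma continuous_paste (X Y : topologicalType) (f g h : X -> Y) (x0 : X) :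
  {for x0, continuous g} -> {for x0, continuous h} ->
  f x0 = g x0 -> f x0 = h x0 -> (\forall x \near x0, f x = g x \/ f x = h x) ->
  {for x0, continuous f}.
Proof.
move=> cg ch fg fh near_gh U; rewrite /= fg => Ug.
have Uh : nbhs (h x0) U by rewrite -fh fg.
have {}Ug := cg _ Ug; have {}Uh := ch _ Uh; rewrite !nbhs_simpl/= in Ug Uh *.
near=> x; have : f x = g x \/ f x = h x by near: x.
by move=> fgh; change (U (f x)); case: fgh => ->; near: x.
Unshelve. all: by end_near. Qed.

Lemma continuous_compT (X Y Z : topologicalType) (f : X -> Y) (g : Y -> Z) :
  continuous f -> continuous g -> continuous (fun x => g (f x)).
Proof. by move=> cf cg x; apply: continuous_comp; [exact: cf|exact: cg]. Qed.

Lemma continuous_pairT (X Y Z : topologicalType) (f : X -> Y) (g : X -> Z) :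
  continuous f -> continuous g -> continuous (fun x => (f x, g x)).
Proof. by move=> cf cg x; apply: cvg_pair; [exact: cf|exact: cg]. Qed.

Section ContinuousReal.
Variables (R : realType) (X : topologicalType).
Implicit Types f g : X -> R.

Lemma continuousDT f g : continuous f -> continuous g -> continuous (fun x => f x + g x).
Proof. by move=> cf cg x; apply: (@continuousD R R^o X f g x); [exact: cf|exact: cg]. Qed.

Lemma continuousBT f g : continuous f -> continuous g -> continuous (fun x => f x - g x).
Proof. by move=> cf cg x; apply: (@continuousB R R^o X f g x); [exact: cf|exact: cg]. Qed.

Lemma continuousMT f g : continuous f -> continuous g -> continuous (fun x => f x * g x).
Proof. by move=> cf cg x; apply: (@continuousM R X f g x); [exact: cf|exact: cg]. Qed.

Lemma continuous_normT f : continuous f -> continuous (fun x => `|f x|).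
Proof.
move=> cf x; apply: (@continuous_comp _ _ _ f (fun y : R => `|y|)); first exact: cf.
exact: norm_continuous.
Qed.

Lemma continuous_cstT (r : R) : continuous (fun _ : X => r).
Proof. by move=> x; exact: cvg_cst. Qed.
End ContinuousReal.

Lemma continuous_fstT (X Y : topologicalType) : continuous (@fst X Y).
Proof. by move=> x; exact: cvg_fst. Qed.
Lemma continuous_sndT (X Y : topologicalType) : continuous (@snd X Y).
Proof. by move=> x; exact: cvg_snd. Qed.

Ltac cont := repeat first [exact: continuous_cstT | exact: continuous_fstT
  | exact: continuous_sndT | assumption | apply: continuousBT | apply: continuousDT
  | apply: continuousMT | apply: continuous_normT ].

Section Clamp.
Variable R : realType.
Implicit Types a b x y t : R.

Definition clamp a b x : R := Num.max a (Num.min x b).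

Lemma clamp_continuous a b : continuous (clamp a b).
Proof.
rewrite /clamp.
(* Maximum and minimum of two numbers are half their sum plus or minus half their distance; in this
   form [cont] applies. *)
have -> : (fun x : R => Num.max a (Num.min x b)) =
    (fun x => (a + ((x + b - `|x - b|) / 2) + `|a - ((x + b - `|x - b|) / 2)|) / 2).
  apply/funext => x; rewrite /Num.max /Num.min.
  have [xb|bx] := ltP x b.
    have -> : (x + b - `|x - b|) / 2 = x by rewrite ltr0_norm; lra.
    by have [ax|xa] := ltP a x; [rewrite ltr0_norm|rewrite ger0_norm]; lra.
  have -> : (x + b - `|x - b|) / 2 = b by rewrite ger0_norm; lra.
  by have [ax|xa] := ltP a b; [rewrite ltr0_norm|rewrite ger0_norm]; lra.
have cid : continuous (fun x : R => x) by move=> x; exact: cvg_id.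
by cont.
Qed.

Lemma clamp_itv a b x : a <= b -> a <= clamp a b x <= b.
Proof. by move=> ab; rewrite /clamp le_max lexx/= ge_max ab ge_min lexx orbT. Qed.

Lemma clamp_id a b x : a <= x <= b -> clamp a b x = x.
Proof. by move=> /andP[ax xb]; rewrite /clamp (min_idPl xb) (max_idPr ax). Qed.

Lemma clamp_mono_lip a b t t' : t <= t' ->
  0 <= clamp a b t' - clamp a b t <= t' - t.
Proof.
move=> tt; rewrite /clamp.
have /andP[m1 m2] : 0 <= Num.min t' b - Num.min t b <= t' - t.
  by case: (leP t' b) => ?; case: (leP t b) => ?; apply/andP; split; lra.
move: (Num.min t' b) (Num.min t b) m1 m2 => u' u m1 m2.
by case: (leP a u') => ?; case: (leP a u) => ?; apply/andP; split; lra.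
Qed.
End Clamp.

Section Glue.
Variable R : realType.

(** Same formula as [edge_loop], which unfolds to an instance, but with arbitrary pieces, so that
    homotopies can be built piece by piece. Parameters are always written n + (j + x) / N. *)
Definition glue (Y : Type) (N : nat) (P : nat -> R -> Y) (t : R) : Y :=
  let u := (t - (Num.floor t)%:~R) * N%:R in
  let j := Num.truncn u in
  P j (u - j%:R).

Lemma glueE (Y : Type) (N : nat) (P : nat -> R -> Y) (n : int) (j : nat) (x : R) :
  (j < N)%N -> 0 <= x < 1 -> glue N P (n%:~R + (j%:R + x) / N%:R) = P j x.
Proof.
move=> jN /andP[x0 x1].
have N0 : 0 < N%:R :> R by rewrite ltr0n (leq_ltn_trans _ jN).
have jx0 : 0 <= (j%:R + x) / N%:R by rewrite divr_ge0 ?ler0n// addr_ge0.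
have jx1 : (j%:R + x) / N%:R < 1.
  rewrite ltr_pdivrMr// mul1r; apply: (@lt_le_trans _ _ (j.+1%:R)).
    by rewrite -natr1 ltrD2l.
  by rewrite ler_nat.
have fl : Num.floor (n%:~R + (j%:R + x) / N%:R) = n.
  by apply: floor_def; rewrite intrD; apply/andP; split; lra.
rewrite /glue fl addrC addKr divfK ?gt_eqF//.
suff -> : Num.truncn (j%:R + x) = j by rewrite addrC addKr.
by apply: truncn_def; rewrite -natr1; apply/andP; split; lra.
Qed.

(** At x = 1 the truncation jumps to the next piece, cyclically, whence the matching condition
    modulo N. *)
Lemma glueE1 (Y : Type) (N : nat) (P : nat -> R -> Y) (n : int) (j : nat) (x : R) :
  (forall i, (i < N)%N -> P i 1 = P (i.+1 %% N)%N 0) ->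
  (j < N)%N -> 0 <= x <= 1 -> glue N P (n%:~R + (j%:R + x) / N%:R) = P j x.
Proof.
move=> PP jN /andP[x0]; rewrite le_eqVlt => /predU1P[->|x1]; last first.
  by rewrite glueE// x0.
have N0 : N%:R != 0 :> R by rewrite pnatr_eq0 -lt0n (leq_ltn_trans _ jN).
rewrite PP//; have [jN'|] := ltnP j.+1 N.
  rewrite modn_small// -(@glueE Y N P n j.+1 0)// ?ltr01 ?lexx//.
  by rewrite addr0 natr1.
move=> Nj; have -> : N = j.+1 by apply/eqP; rewrite eqn_leq jN Nj.
rewrite modnn -(@glueE Y j.+1 P (n + 1) 0%N 0)// ?ltr01 ?lexx//.
by rewrite natr1 divff ?pnatr_eq0// add0r mul0r addr0 intrD.
Qed.

Lemma glue_coord (N : nat) (t : R) : (0 < N)%N -> exists (n : int) (j : nat) (x : R),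
  [/\ (j < N)%N, 0 <= x < 1 & t = n%:~R + (j%:R + x) / N%:R].
Proof.
move=> N0; pose n := Num.floor t; pose u := (t - n%:~R) * N%:R.
have NR0 : 0 < N%:R :> R by rewrite ltr0n.
have := real_floor_itv (num_real t); rewrite -/n intrD => /andP[nt tn].
have u0 : 0 <= u by rewrite mulr_ge0 ?ler0n// subr_ge0.
have := truncn_itv u0 => /andP[ju uj].
exists n, (Num.truncn u), (u - (Num.truncn u)%:R); split.
- rewrite -(ltr_nat R); apply: (le_lt_trans ju).
  by rewrite /u -[ltRHS]mul1r ltr_pM2r//; lra.
- by rewrite -natr1 in uj; apply/andP; split; lra.
by rewrite subrKC /u mulfK ?gt_eqF//; lra.
Qed.

Lemma glue_periodic (Y : Type) (N : nat) (P : nat -> R -> Y) : periodic1 (glue N P).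
Proof.
by move=> t; rewrite /glue floorDrz ?rpred1// floor1 intrD opprD addrACA subrr addr0.
Qed.

Lemma glue_continuous (S Y : topologicalType) (N : nat) (P : nat -> R * S -> Y) :
  (0 < N)%N ->
  (forall j, (j < N)%N -> continuous (P j)) ->
  (forall j s, (j < N)%N -> P j (1, s) = P (j.+1 %% N)%N (0, s)) ->
  continuous (fun p : R * S => glue N (fun j u => P j (u, p.2)) p.1).
Proof.
move=> N0 cP PP [t0 s0]; have [n [j [x [jN x01 t0E]]]] := glue_coord t0 N0.
have NR0 : 0 < N%:R :> R by rewrite ltr0n.
pose G (m : int) (i : nat) (p : R * S) := P i ((p.1 - m%:~R) * N%:R - i%:R, p.2).
have Gc m i : (i < N)%N -> continuous (G m i).
  move=> iN; apply: (continuous_compT _ (cP _ iN)).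
  by apply: continuous_pairT; cont.
have GE m i p : (i < N)%N -> 0 <= (p.1 - m%:~R) * N%:R - i%:R <= 1 ->
    glue N (fun j u => P j (u, p.2)) p.1 = G m i p.
  move=> iN z01.
  have E : p.1 = m%:~R + (i%:R + ((p.1 - m%:~R) * N%:R - i%:R)) / N%:R.
    by rewrite subrKC mulfK ?gt_eqF// subrKC.
  by rewrite [in LHS]E glueE1// => k kN; rewrite PP.
have t0n : (t0 - n%:~R) * N%:R - j%:R = x.
  by rewrite t0E (addrC n%:~R) addrK divfK ?gt_eqF// (addrC j%:R) addrK.
(* The piece that ends where piece j of period n begins; for j = 0 it is the last piece of the
   preceding period. *)
have [n' [j' [jN' tE]]] : exists (n' : int) (j' : nat), (j' < N)%N /\
    n'%:~R + (j'.+1)%:R / N%:R = n%:~R + j%:R / N%:R :> R.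
  case: (posnP j) => [->|j0]; last first.
    by exists n, j.-1; rewrite prednK//; split => //; exact: ltnW.
  exists (n - 1), N.-1; rewrite prednK//; split=> //.
  by rewrite divff ?gt_eqF// mul0r addr0 intrB subrK.
have cz : {for (t0, s0), continuous (fun p : R * S => (p.1 - n%:~R) * N%:R - j%:R)}.
  by have : continuous (fun p : R * S => (p.1 - n%:~R) * N%:R - j%:R) by [cont]; exact.
have tn' (t : R) : (t - n'%:~R) * N%:R - j'%:R = ((t - n%:~R) * N%:R - j%:R) + 1.
  have : n'%:~R * N%:R + j'%:R + 1 = n%:~R * N%:R + j%:R :> R.
    have := congr1 (fun z => z * N%:R) tE.
    by rewrite /= !mulrDl !divfK ?gt_eqF// -natr1 addrA.
  by lra.
case/andP: x01 => x0; case: (eqVneq x 0) => [x00 _|xn0 x1].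
  apply: (@continuous_paste _ _ _ (G n j) (G n' j')); [exact: Gc|exact: Gc|..].
  - by apply: GE => //=; rewrite t0n x00 lexx ler01.
  - by apply: GE => //=; rewrite tn' t0n x00 add0r ler01 lexx.
  near=> p.
  have : `|(p.1 - n%:~R) * N%:R - j%:R - x| < 1.
    rewrite distrC -t0n; near: p; exact: (@cvgr_dist_lt _ _ _ _ _ _ _ cz _ ltr01).
  rewrite x00 subr0 ltr_norml => /andP[h1 h2].
  have [h0|h0] := leP 0 ((p.1 - n%:~R) * N%:R - j%:R).
    by left; apply: GE => //; rewrite h0 ltW.
  by right; apply: GE => //; rewrite tn'; apply/andP; split; lra.
apply: (@continuous_paste _ _ _ (G n j) (G n j)); [exact: Gc|exact: Gc|..].
- by apply: GE => //=; rewrite t0n x0 ltW.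
- by apply: GE => //=; rewrite t0n x0 ltW.
have x0' : 0 < x by rewrite lt_neqAle eq_sym xn0.
near=> p; left; apply: GE => //.
have : `|(p.1 - n%:~R) * N%:R - j%:R - x| < Num.min x (1 - x).
  rewrite distrC -[X in `|X - _| < _]t0n; near: p; apply: (@cvgr_dist_lt _ _ _ _ _ _ _ cz _ _).
  by rewrite lt_min x0' subr_gt0.
by rewrite lt_min !ltr_norml => /andP[/andP[? ?] /andP[? ?]]; apply/andP; split; lra.
Unshelve. all: by end_near. Qed.
End Glue.

(** * Lipschitz functions on an interval *)

Lemma lebesgue_measure_cc (R : realType) (a b : R) : a <= b ->
  @lebesgue_measure R `[a, b]%classic = (b - a)%:E.
Proof.
rewrite lebesgue_measure_itv/= lte_fin le_eqVlt => /predU1P[->|->]; last by rewrite EFinB.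
by rewrite ltxx subrr.
Qed.

Lemma integrable_cst_itv (R : realType) (a b k : R) :
  (@lebesgue_measure R).-integrable `[a, b] (EFin \o cst k).
Proof.
apply/integrableP; split; first by apply/measurable_EFinP; exact: measurable_cst.
under eq_integral do rewrite /= /cst.
rewrite integral_cst//=; have [ab|ba] := leP a b.
  by have := lebesgue_measure_cc ab; rewrite /= => ->; rewrite -EFinM ltry.
by rewrite set_itv_ge ?bnd_simp -?ltNge// measure0 mule0 ltry.
Qed.

Section LipschitzDensity.
Variable R : realType.
Local Notation mu := (@lebesgue_measure R).
Variables (A L : R) (h : R -> R).
Hypotheses (A0 : 0 <= A) (L0 : 0 < L).
Hypothesis lip : forall x y : R, x \in `[0, A] -> y \in `[0, A] ->
  `|h x - h y| <= L * `|x - y|.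

Let c : R -> R := clamp 0 A.

Let cE (x : R) : x \in `[0, A] -> c x = x.
Proof. by rewrite in_itv; exact: clamp_id. Qed.

Let c_in x : c x \in `[0, A].
Proof. by rewrite in_itv; exact: clamp_itv. Qed.

Let c_nd x y : x <= y -> c x <= c y.
Proof. by move=> xy; rewrite -subr_ge0; have /andP[] := clamp_mono_lip 0 A xy. Qed.

Let c_lip x y : x <= y -> c y - c x <= y - x.
Proof. by move=> xy; have /andP[] := clamp_mono_lip 0 A xy. Qed.

Let hlip x y : x <= y -> `|h (c y) - h (c x)| <= L * (c y - c x).
Proof.
move=> xy; apply: (le_trans (lip (c_in _) (c_in _))).
by rewrite ger0_norm// subr_ge0 c_nd.
Qed.

(** The slopes of h lie between -L and L, so those of F lie between 0 and 1. Hence F and the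
    complement G = id - F are both nondecreasing, and their Stieltjes measures split Lebesgue
    measure. *)
Let F x : R := (h (c x) + L * c x) / (2 * L).
Let G x : R := x - F x.

Let FB x y : F y - F x = (h (c y) - h (c x) + L * (c y - c x)) / (2 * L).
Proof. by rewrite /F; field; rewrite gt_eqF. Qed.

Let FB_ge0 x y : x <= y -> 0 <= F y - F x.
Proof.
move=> xy; rewrite FB divr_ge0//; last by rewrite mulr_ge0// ltW.
by have := hlip xy; rewrite ler_norml => /andP[? ?]; lra.
Qed.

Let FB_le x y : x <= y -> F y - F x <= y - x.
Proof.
move=> xy; rewrite FB ler_pdivrMr ?mulr_gt0//.
have := hlip xy; rewrite ler_norml => /andP[_ h1].
have : L * (c y - c x) <= L * (y - x) by rewrite ler_pM2l// c_lip.
lra.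
Qed.

Let cont_of_lip (f : R -> R) :
  (forall x y, x <= y -> `|f y - f x| <= y - x) -> continuous f.
Proof.
move=> fl x; apply/cvgrPdist_le => e e0; near=> y.
have xye : `|x - y| < e by near: y; exact: (@nbhsx_ballx _ R^o x e).
have [xy|yx] := leP x y.
  by rewrite distrC; apply: (le_trans (fl _ _ xy)); move: xye; rewrite ltr_norml => /andP[? ?]; lra.
by apply: (le_trans (fl _ _ (ltW yx))); move: xye; rewrite ltr_norml => /andP[? ?]; lra.
Unshelve. all: by end_near. Qed.

Let F_nd : nondecreasing F.
Proof. by move=> x y xy; rewrite -subr_ge0 FB_ge0. Qed.

Let G_nd : nondecreasing G.
Proof. by move=> x y xy; rewrite /G; have := FB_le xy; lra. Qed.

Let F_c : continuous F.
Proof. by apply: cont_of_lip => x y xy; rewrite ger0_norm ?FB_ge0 ?FB_le. Qed.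

Let G_c : continuous G.
Proof.
apply: cont_of_lip => x y xy; rewrite /G ger0_norm; last by have := FB_le xy; lra.
by have := FB_ge0 xy; lra.
Qed.

HB.instance Definition _ := isCumulative.Build R _ R F F_nd (right_continuousW F_c).
HB.instance Definition _ := isCumulative.Build R _ R G G_nd (right_continuousW G_c).

Let nu : {measure set (measurableTypeR R) -> \bar R} := lebesgue_stieltjes_measure F.
Let nu' : {measure set (measurableTypeR R) -> \bar R} := lebesgue_stieltjes_measure G.

Let LS_itv (f : cumulative R R) (a b : R) : a <= b ->
  lebesgue_stieltjes_measure f `]a, b]%classic = (f b - f a)%:E.
Proof.
move=> ab; rewrite /lebesgue_stieltjes_measure /measure_extension/=.
rewrite measurable_mu_extE/=; last exact: is_ocitv.
by rewrite wlength_itv_bnd.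
Qed.

(** The increments of F and G over a half-open interval add up to its length, and such intervals
    determine Lebesgue measure. It follows that nu <= mu, so that nu is absolutely continuous. *)
Let nuD X : measurable X -> mu X = (nu X + nu' X)%E.
Proof.
move=> mX; transitivity (measure_add nu nu' X); last by rewrite measure_addE.
apply: (@lebesgue_measure_unique R (measure_add nu nu')) => // Y.
move=> [[a b]] /= _ <-.
transitivity (nu `]a, b]%classic + nu' `]a, b]%classic)%E; last first.
  exact/esym/(measure_addE nu nu').
have [ab|ba] := leP a b; last by rewrite set_itv_ge ?measure0 ?adde0// -leNgt bnd_simp ltW.
rewrite [LHS](@LS_itv idfun)// [X in (X + _)%E](@LS_itv F)// [X in (_ + X)%E](@LS_itv G)//.
rewrite -EFinD; congr EFin; change (b - a = F b - F a + ((b - F b) - (a - F a))); ring.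
Qed.

Let nu_le X : measurable X -> (nu X <= mu X)%E.
Proof. by move=> mX; rewrite nuD// leeDl. Qed.

Let nuA : (nu `[0%R, A]%classic < +oo)%E.
Proof.
have : measurable (`[0, A]%classic : set (measurableTypeR R)) by exact: measurable_itv.
move/nu_le => /le_lt_trans; apply.
by rewrite lebesgue_measure_itv/=; case: ifP => _ ; rewrite ltry.
Qed.

Let hE (x : R) : x \in `[0, A] -> h x = 2 * L * F x - L * x.
Proof. by move=> xA; rewrite /F cE//; field; rewrite gt_eqF. Qed.

Let density : exists q : R -> R, mu.-integrable setT (EFin \o q) /\
  forall a b, 0 <= a -> a <= b -> b <= A -> F b - F a = \int[mu]_(x in `[a, b]) q x.
Proof.
have mA : measurable (`[0, A]%classic : set (measurableTypeR R)) by exact: measurable_itv.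
pose N : {finite_measure set (measurableTypeR R) -> \bar R} := mfrestr mA nuA.
have [|p [p0 pfin pint pE]] := @radon_nikodym_sigma_finite _ _ _ mu N.
  apply/null_content_dominatesP => X mX X0; apply/eqP; rewrite -measure_le0.
  change (nu (X `&` `[0%R, A]) <= 0)%E.
  rewrite -X0; apply: (le_trans (nu_le _)); first exact: measurableI.
  by apply: le_measure; rewrite ?inE//; exact: measurableI.
pose q : R -> R := fine \o p.
have qp : EFin \o q = p by apply/funext => x /=; rewrite fineK.
have qint : mu.-integrable setT (EFin \o q) by rewrite qp.
have qintS (i : interval R) : mu.-integrable [set` i] (EFin \o q).
  by apply: integrableS qint.
exists q; split=> // a b.
  move=> a0 ab bA; rewrite -Rintegral_itv_obnd_cbnd//.
  rewrite /Rintegral; under eq_integral do rewrite -[_%:E]/((EFin \o q) _) qp.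
  rewrite -pE; last exact: measurable_itv.
  change (F b - F a = fine (nu (`]a, b]%classic `&` `[0, A]%classic))).
  rewrite setIidl; last first.
    by move=> x /=; rewrite !in_itv/= => /andP[ax xb]; apply/andP; lra.
  by rewrite [nu _](@LS_itv F).
Qed.

(* Up to an affine map h is nondecreasing with increments at most those of the
   identity, so its Stieltjes measure has a Radon-Nikodym density. *)
Lemma lipschitz_density : exists g : R -> R,
  [/\ mu.-integrable `[0, A] (EFin \o g),
      forall a b, 0 <= a -> a <= b -> b <= A ->
        (h b - h a = \int[mu]_(x in `[a, b]) g x)%R &
      {ae mu, forall x, x \in `]0, A[ -> is_derive x 1 h (g x)}].
Proof.
have [q [qint qE]] := density.
have qintS (i : interval R) : mu.-integrable [set` i] (EFin \o q).
  by apply: integrableS qint.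
have idint (i : R) := integrable_cst_itv 0 A i.
have lint (i : interval R) : mu.-integrable [set` i] (EFin \o (fun x => 2 * L * q x)).
  rewrite (_ : _ \o _ = fun x => (2 * L)%:E * (EFin \o q) x)%E; last first.
    by apply/funext => x /=; rewrite EFinM.
  by apply: integrableZl.
exists (fun x => 2 * L * q x - L); split.
- rewrite (_ : _ \o _ = (EFin \o (fun x => 2 * L * q x)%R) \- (EFin \o cst L))%E//.
  exact: (integrableB _ (lint _) (idint L)).
- move=> a b a0 ab bA.
  have sab : `[a, b]%classic `<=` `[0, A]%classic.
    by move=> x /=; rewrite !in_itv/= => /andP[ax xb]; apply/andP; lra.
  have iL : mu.-integrable `[a, b] (EFin \o cst L).
    by apply: integrableS (idint L) => //; exact: measurable_itv.
  rewrite (RintegralB _ (lint `[a, b]) iL)//.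
  rewrite (RintegralZl _ _ (qintS `[a, b]))// -qE// Rintegral_cst//.
  have -> : fine (mu `[a, b]%classic) = b - a by rewrite lebesgue_measure_cc.
  by rewrite !hE ?in_itv/=; first ring; apply/andP; lra.
have locq : locally_integrable setT q.
  by apply: open_integrable_locally => //; exact: openT.
(* Lebesgue differentiation: the integral of q has derivative q almost everywhere, and near interior
   points h is an affine combination of this integral and the identity. *)
have := @FTC1 _ q (BLeft 0) (fun y => qintS _) locq.
apply: filterS; first exact: (ae_filter_ringOfSetsType mu).
move=> x /= + xA; move: (xA); rewrite in_itv/= => /andP[x0 xltA].
have x0E : (0%:E < x%:E)%E by rewrite lte_fin.
move=> /(_ x0E) [dQ Q'].
have : is_derive x 1 (fun x => \int[mu]_(t in `[0, x]) q t) (q x).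
  by apply: DeriveDef => //; rewrite -derive1E.
set Q := (fun x : R => _) => DQ.
have {}DQ : is_derive x (1:R) ((2 * L) *: Q - L *: id + cst (2 * L * F 0)) (2 * L * q x - L).
  apply: is_derive_eq => /=; first by rewrite addr0 -[_ *: _]/(_ * _) -[L *: _]/(_ * _) mulr1.
apply: near_eq_is_derive DQ; near=> y.
have yA : y \in `]0, A[ by near: y; exact: near_in_itvoo.
have {}yA : 0 < y < A by [].
rewrite hE; last by rewrite in_itv/=; apply/andP; lra.
have := @qE 0 y (lexx _); case/andP: yA => y0 yltA.
move=> /(_ (ltW y0) (ltW yltA)) yQ.
change (2 * L * Q y - L * y + 2 * L * F 0 = 2 * L * F y - L * y).
rewrite /Q -yQ; ring.
Unshelve. all: by end_near. Qed.

End LipschitzDensity.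

(* No measurability is needed for the larger function: the integral of a
   nonnegative function is a supremum over the simple functions below it. *)
Lemma le_lower_integral d (T : measurableType d) (R : realType)
    (mu : {measure set T -> \bar R}) (D : set T) (f1 f2 : T -> \bar R) :
  (forall x, D x -> 0 <= f1 x)%E -> (forall x, D x -> f1 x <= f2 x)%E ->
  (\int[mu]_(x in D) f1 x <= \int[mu]_(x in D) f2 x)%E.
Proof.
move=> f10 f12.
have f20 x : D x -> (0 <= f2 x)%E by move=> Dx; apply: le_trans (f12 _ Dx); exact: f10.
rewrite !ge0_integralE//; apply: ereal_sup_le => _ /= [h hf <-].
exists h => // x; apply: (le_trans (hf x)).
by rewrite !patchE; case: ifPn => // /set_mem; exact: f12.
Qed.

Section LipschitzEnergy.
Variable R : realType.
Local Notation mu := (@lebesgue_measure R).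

(** V is the integral of |h'|. The second clause integrates 2c|h'| - c^2 <= 2c sp - c^2 <= sp^2.
    This form of Cauchy-Schwarz is linear in V, so it can be summed over edges with a different c on
    each, and it allows an infinite right-hand side. *)
Lemma lipschitz_energy (A L : R) (h sp : R -> R) :
  0 <= A -> 0 < L ->
  (forall x y : R, x \in `[0, A] -> y \in `[0, A] -> `|h x - h y| <= L * `|x - y|) ->
  (forall s d : R, s \in `]0, A[ -> is_derive s (1:R) h d -> `|d| <= sp s) ->
  exists V : R,
    (forall (t : nat -> R) n, (forall i, t i \in `[0, A]) ->
       (forall i, t i <= t i.+1) ->
       \sum_(i < n) `|h (t i.+1) - h (t i)| <= V) /\
    (forall c : R, 0 <= c ->
      ((2 * c * V - c ^+ 2 * A)%:E
        <= \int[mu]_(s in `[0%R, A]) ((sp s) ^+ 2)%:E)%E).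
Proof.
move=> A0 L0 lip hsp; have [g [gint gE gd]] := lipschitz_density A0 L0 lip.
have sub (a b : R) : 0 <= a -> b <= A -> `[a, b]%classic `<=` `[0, A]%classic.
  by move=> a0 bA x /=; rewrite !in_itv/= => /andP[ax xb]; apply/andP; lra.
have aint a b : 0 <= a -> b <= A -> mu.-integrable `[a, b] (EFin \o (fun x => `|g x|)).
  move=> a0 bA; apply: (@integrableS _ _ _ mu `[0, A]) => //; first exact: sub.
  by rewrite (_ : _ \o _ = abse \o (EFin \o g))//; apply: integrable_abse.
have cint c : mu.-integrable `[0, A] (EFin \o cst c) := integrable_cst_itv 0 A c.
exists (\int[mu]_(x in `[0, A]) `|g x|); split.
  move=> t n tA tm.
  have inA i : 0 <= t i /\ t i <= A by have := tA i; rewrite in_itv/= => /andP[].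
  have hle i : `|h (t i.+1) - h (t i)| <=
      (\int[mu]_(x in `[0, t i.+1]) `|g x| - \int[mu]_(x in `[0, t i]) `|g x|).
    have [ti0 tiA] := inA i; have [si0 siA] := inA i.+1.
    rewrite gE// (@Rintegral_itvB _ _ (BLeft 0) (BRight (t i.+1)) (t i)) ?bnd_simp//; last exact: aint.
    rewrite -Rintegral_itv_obnd_cbnd; last first.
      apply: (@integrableS _ _ _ mu `[0, A]) gint => //.
      by apply: (@subset_trans _ `[t i, t i.+1]); [exact: subset_itv_oc_cc|exact: sub].
    apply: le_normr_Rintegral => //.
    apply: (@integrableS _ _ _ mu `[0, A]) gint => //.
    by apply: (@subset_trans _ `[t i, t i.+1]); [exact: subset_itv_oc_cc|exact: sub].
  pose I i := \int[mu]_(x in `[0, t i]) `|g x|.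
  apply: (@le_trans _ _ (\sum_(i < n) (I i.+1 - I i))).
    by apply: ler_sum => i _; exact: hle.
  rewrite -(big_mkord xpredT (fun i => I i.+1 - I i)).
  rewrite telescope_sumr//; apply: (@le_trans _ _ (I n)).
    by rewrite gerBl; apply: Rintegral_ge0.
  have [t0 tnA] := inA n.
  rewrite -subr_ge0 (@Rintegral_itvB _ _ (BLeft 0) (BRight A) (t n)) ?bnd_simp//; last exact: aint.
  exact: Rintegral_ge0.
move=> c c0; pose k x := 2 * c * `|g x| - c ^+ 2.
have lint : mu.-integrable `[0, A] (EFin \o (fun x => 2 * c * `|g x|)).
  rewrite (_ : _ \o _ = fun x => (2 * c)%:E * (EFin \o (fun x => `|g x|)%R) x)%E; last first.
    by apply/funext => x /=; rewrite EFinM.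
  by apply: integrableZl => //; exact: aint.
have kint : mu.-integrable `[0, A] (EFin \o k).
  rewrite (_ : _ \o _ = (EFin \o (fun x => 2 * c * `|g x|)%R) \- (EFin \o cst (c ^+ 2)%R))%E//.
  exact: integrableB.
have -> : 2 * c * (\int[mu]_(x in `[0, A]) `|g x|) - c ^+ 2 * A = \int[mu]_(x in `[0, A]) k x.
  rewrite (RintegralB _ lint (cint _))// (RintegralZl _ _ (aint _ _ _ _))// Rintegral_cst//.
  by have -> : fine (mu `[0, A]%classic) = A by rewrite lebesgue_measure_cc// subr0.
rewrite /Rintegral fineK; last exact: integrable_fin_num.
have [N [mN N0 subN]] := gd.
(* The two ends join the null set, as [hsp] bounds derivatives only in the open interval. *)
pose N' := N `|` ([set 0] `|` [set A]).
have mN' : measurable N' by do 2?apply: measurableU => //; exact: measurable_set1.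
have N'0 : mu N' = 0%E.
  have m01 : mu ([set 0] `|` [set A]) = 0%E.
    by rewrite measureU0; do ?[exact: measurable_set1|exact: lebesgue_measure_set1].
  by rewrite measureU0//; apply: measurableU; exact: measurable_set1.
rewrite (@negligible_integral _ _ _ mu _ N')//; rewrite setDE integral_mkcondr.
pose k2 : R -> \bar R := (EFin \o k) \_ (~` N').
change (\int[mu]_(x in `[0%R, A]) k2 x <= \int[mu]_(s in `[0%R, A]) ((sp s) ^+ 2)%:E)%E.
(* The integrand k2 may be negative; its positive part is what [le_lower_integral] can compare with
   sp^2, whose measurability is unknown. *)
apply: (@le_trans _ _ (\int[mu]_(x in `[0%R, A]) (k2^\+ x))%E).
  rewrite integralE -[leRHS]adde0; apply: leeD => //; rewrite oppe_le0.
  by apply: integral_ge0.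
apply: le_lower_integral => x; first by [].
rewrite /= in_itv/= => /andP[x0 xA].
rewrite funeposE ge_max; apply/andP; split; last by rewrite lee_fin sqr_ge0.
rewrite /k2 patchE; case: ifPn; last by rewrite lee_fin sqr_ge0.
move=> /set_mem xN'; rewrite lee_fin /k.
have x0' : x != 0 by apply/eqP => x00; apply: xN'; right; left.
have xA' : x != A by apply/eqP => x00; apply: xN'; right; right.
have xI : x \in `]0, A[ by rewrite in_itv/= !lt_neqAle eq_sym x0' xA' x0 xA.
have dx : is_derive x (1:R) h (g x).
  have : ~ N x by move=> Nx; apply: xN'; left.
  by move=> nNx; apply: contrapT => ndx; apply: nNx; apply: subN => /= /(_ xI).
have := hsp _ _ xI dx; have := normr_ge0 (g x).
move: `|g x| (sp x) => u v u0 uv.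
have : c * u <= c * v by rewrite ler_wpM2l.
by have := sqr_ge0 (v - c); rewrite sqrrB; lra.
Qed.

End LipschitzEnergy.

Section AverageCrossings.
Variable R : realType.
Local Notation mu := (@lebesgue_measure R).

(** Integrate the count over th in ]a, b]. The levels of ]a, b] that separate x i from y i lie
    between the clamped values of x i and y i, which bounds their measure by the i-th summand. *)
Lemma average_crossings (N n : nat) (P : pred nat) (x y : nat -> R) (a b : R) :
  a <= b ->
  (forall th : R, a < th <= b ->
    (n <= \sum_(i < N | P i) ((x i < th <= y i)%R || (y i < th <= x i)%R))%N) ->
  n%:R * (b - a) <= \sum_(i < N | P i) `|clamp a b (y i) - clamp a b (x i)|.
Proof.
move=> ab hn.
pose c := clamp a b.
pose J i : set R := `]Num.min (c (x i)) (c (y i)), Num.max (c (x i)) (c (y i))]%classic.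
have mJ i : measurable (J i) by exact: measurable_itv.
have muJ i : mu (J i) = (`|c (y i) - c (x i)|)%:E.
  rewrite /J lebesgue_measure_itv/= lte_fin; case: (ltgtP (c (x i)) (c (y i))) => [h|h|->].
  - by rewrite h -EFinB ger0_norm// subr_ge0 ltW.
  - by rewrite h -EFinB ler0_norm ?opprB// subr_le0 ltW.
  - by rewrite ltxx subrr normr0.
have h1 : ((n%:R * (b - a))%:E = \int[mu]_(t in `]a, b]) n%:R%:E)%E.
  have muab : mu `]a, b]%classic = (b - a)%:E.
    rewrite lebesgue_measure_itv/= lte_fin; move: ab.
    by rewrite le_eqVlt => /predU1P[->|ab]; rewrite ?ltxx ?subrr// ab -EFinB.
  by move: muab; rewrite integral_cst//= => ->; rewrite EFinM.
rewrite -lee_fin h1 -sumEFin.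
under eq_bigr do rewrite -muJ.
have JE i th : a < th <= b -> ((x i < th <= y i) || (y i < th <= x i)) -> J i th.
  move=> /andP[ath thb]; rewrite /J /= in_itv/= /c /clamp => h.
  rewrite gt_min le_max !gt_max !le_max !gt_min !le_min ath thb/=.
  by case/orP: h => /andP[-> ->]; rewrite ?orbT.
pose s : seq 'I_N := [seq i <- index_enum 'I_N | P (i : 'I_N)].
rewrite -[leRHS](big_filter _ (fun i : 'I_N => P i)) -/s.
apply: (@le_trans _ _ (\int[mu]_(t in `]a, b]) (\sum_(i <- s) (\1_(J i) t)%:E))%E).
  apply: ge0_le_integral => //.
  - by apply: emeasurable_sum => i; apply/measurable_EFinP; apply: measurable_indic; exact: mJ.
  - move=> t; rewrite /= in_itv/= => tab; rewrite big_filter sumEFin lee_fin.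
    rewrite (le_trans (y := (\sum_(i < N | P i) ((x i < t <= y i)%R || (y i < t <= x i)%R))%N%:R))//.
      by rewrite ler_nat hn.
    rewrite natr_sum; apply: ler_sum => i _.
    case: (boolP ((x i < t <= y i) || _)) => // h.
    by rewrite indicE mem_set//; exact: JE.
rewrite ge0_integral_sum//; last by move=> i; apply/measurable_EFinP; apply: measurable_indic; exact: mJ.
apply: lee_sum => i _; rewrite integral_indic//; last exact: mJ.
apply: le_measure; rewrite ?inE; [|exact: mJ|exact: subIsetl].
by apply: measurableI; [exact: mJ|exact: measurable_itv].
Qed.

End AverageCrossings.

(** * Loops in a graph and their taut words *)

Section LoopHomotopy.
Variable R : realType.

(* Homotopies of loops with a parameter running over the whole line: no subspace
   topology is involved. *)
Definition line_homotopic (Y : topologicalType) (c d : R -> Y) : Prop :=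
  exists H : R * R -> Y, [/\ continuous H, forall s, periodic1 (fun t => H (t, s)),
    forall t, H (t, 0) = c t & forall t, H (t, 1) = d t].

(** Clamping the second parameter to [0, 1] extends a homotopy to the whole line. *)
Lemma line_homotopicP (Y : topologicalType) (c d : R -> Y) :
  loop_homotopic c d <-> line_homotopic c d.
Proof.
split; last first.
  case=> H [cH pH H0 H1]; exists H; split=> //.
  exact: continuous_subspaceT.
case=> H [/subspace_continuousP cH pH H0 H1].
exists (fun p => H (p.1, clamp 0 1 p.2)); split.
- move=> p U HU.
  have pA : ([set: R] `*` `[0, 1]%classic) (p.1, clamp 0 1 p.2).
    by split => //=; rewrite in_itv/= clamp_itv.
  have cP : continuous (fun p : R * R => (p.1, clamp 0 1 p.2)).
    by apply: continuous_pairT; [cont|apply: continuous_compT; [cont|exact: clamp_continuous]].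
  have := cP p _ (cH _ pA _ HU); rewrite /= !nbhs_simpl/=.
  apply: filterS => q; apply.
  by split => //=; rewrite in_itv/= clamp_itv.
- move=> s; apply: (pH (clamp 0 1 s)).
  by rewrite in_itv/= clamp_itv.
- by move=> t; rewrite /= clamp_id ?lexx ?ler01.
- by move=> t; rewrite /= clamp_id ?lexx ?ler01.
Qed.

Lemma line_homotopic_sym (Y : topologicalType) (c d : R -> Y) :
  line_homotopic c d -> line_homotopic d c.
Proof.
case=> H [cH pH H0 H1]; exists (fun p => H (p.1, 1 - p.2)); split.
- by apply: continuous_compT cH; apply: continuous_pairT; cont.
- by move=> s; exact: (pH (1 - s)).
- by move=> t /=; rewrite subr0.
- by move=> t /=; rewrite subrr.
Qed.

Lemma line_homotopic_trans (Y : topologicalType) (c d e : R -> Y) :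
  line_homotopic c d -> line_homotopic d e -> line_homotopic c e.
Proof.
case=> H [cH pH H0 H1] [K [cK pK K0 K1]].
pose H' (p : R * R) := H (p.1, 2 * p.2).
pose K' (p : R * R) := K (p.1, 2 * p.2 - 1).
have cH' : continuous H' by apply: continuous_compT cH; apply: continuous_pairT; cont.
have cK' : continuous K' by apply: continuous_compT cK; apply: continuous_pairT; cont.
exists (fun p => if p.2 <= 1/2 then H' p else K' p); split.
- move=> p0; case: (ltgtP p0.2 (1/2)) => hp.
  + apply: (@continuous_paste _ _ _ H' H'); [exact: cH'|exact: cH'|by rewrite ltW..|].
    near=> p; left; rewrite ifT// ltW//; near: p.
    exact: (@continuous_sndT R R p0 _ (lt_nbhsl hp)).
  + apply: (@continuous_paste _ _ _ K' K'); [exact: cK'|exact: cK'|by rewrite leNgt hp..|].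
    near=> p; left; rewrite leNgt ifN// negbK; near: p.
    exact: (@continuous_sndT R R p0 _ (lt_nbhsr hp)).
  + apply: (@continuous_paste _ _ _ H' K'); [exact: cH'|exact: cK'|by rewrite hp lexx|..].
      have -> : K' p0 = H' p0; last by case: ifP.
      have e1 : 2 * p0.2 = 1 by lra.
      by rewrite /H' /K' e1 subrr H1 K0.
    by near=> p; case: ifP; [left|right].
- by move=> s t /=; case: ifP => _; [exact: (pH (2 * s))|exact: (pK (2 * s - 1))].
- by move=> t /=; rewrite divr_ge0// /H' mulr0 H0.
- move=> t /=; rewrite leNgt ifN; last by rewrite negbK; lra.
  by rewrite /K' -K1/=; congr (K (_, _)); lra.
Unshelve. all: by end_near. Qed.

Lemma line_homotopic_push (X Y : topologicalType) (f : X -> Y) (c d : R -> X) :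
  continuous f -> line_homotopic c d -> line_homotopic (f \o c) (f \o d).
Proof.
move=> cf [H [cH pH H0 H1]]; exists (fun p => f (H p)); split.
- exact: continuous_compT cH cf.
- by move=> s t; rewrite [H _](pH s t).
- by move=> t /=; rewrite H0.
- by move=> t /=; rewrite H1.
Qed.

(** Since rho has degree one, its straight-line interpolation to the identity also commutes with t
    -> t + 1 and can be composed with the periodic c. *)
Lemma line_homotopic_reparam (Y : topologicalType) (c : R -> Y) (rho : R -> R) :
  continuous c -> periodic1 c -> continuous rho ->
  (forall t, rho (t + 1) = rho t + 1) -> line_homotopic (c \o rho) c.
Proof.
move=> cc pc cr rD.
exists (fun p => c ((1 - p.2) * rho p.1 + p.2 * p.1)); split.
- apply: continuous_compT cc.
  have : continuous (fun p : R * R => rho p.1) by apply: continuous_compT; [cont|exact: cr].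
  by move=> ?; cont.
- by move=> s t /=; rewrite rD -[RHS]pc; congr c; ring.
- by move=> t /=; rewrite subr0 mul1r mul0r addr0.
- by move=> t /=; rewrite subrr mul1r mul0r add0r.
Qed.

Lemma line_homotopic_refl (Y : topologicalType) (c : R -> Y) :
  continuous c -> periodic1 c -> line_homotopic c c.
Proof.
move=> cc pc; exists (fun p => c p.1); split=> //.
exact: continuous_compT (@continuous_fstT _ _) cc.
Qed.

Lemma line_homotopic_glue (Y : topologicalType) (N : nat) (P : nat -> R * R -> Y) :
  (0 < N)%N -> (forall j, (j < N)%N -> continuous (P j)) ->
  (forall j s, (j < N)%N -> P j (1, s) = P (j.+1 %% N)%N (0, s)) ->
  line_homotopic (glue N (fun j u => P j (u, 0))) (glue N (fun j u => P j (u, 1))).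
Proof.
move=> N0 cP PP; exists (fun p => glue N (fun j u => P j (u, p.2)) p.1); split => //.
- exact: (@glue_continuous R R Y N P N0 cP PP).
- by move=> s; exact: (@glue_periodic R Y N (fun j u => P j (u, s))).
Qed.

Lemma continuous_glue (Y : topologicalType) (N : nat) (P : nat -> R -> Y) :
  (0 < N)%N -> (forall j, (j < N)%N -> continuous (P j)) ->
  (forall j, (j < N)%N -> P j 1 = P (j.+1 %% N)%N 0) -> continuous (glue N P).
Proof.
move=> N0 cP PP.
have cg : continuous (fun p : R * R => glue N P p.1).
  apply: (@glue_continuous R R Y N (fun j p => P j p.1) N0) => [j jN|j s jN]; last exact: PP.
  by apply: continuous_compT; [cont|exact: cP].
have cz : continuous (fun t : R => (t, 0 : R)).
  by apply: continuous_pairT; [move=> x; exact: cvg_id|cont].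
exact: (continuous_compT cz cg).
Qed.

Lemma periodic1z (Y : Type) (c : R -> Y) (n : int) (t : R) :
  periodic1 c -> c (t + n%:~R) = c t.
Proof.
move=> pc; elim: n t => [t|n IH t|n IH t]; first by rewrite addr0.
  by rewrite -addn1 PoszD intrD addrA pc IH.
by rewrite -addn1 PoszD opprD intrD addrA -[LHS]pc subrK IH.
Qed.

End LoopHomotopy.

Lemma near_natinv_lt (R : realType) (d : R) : 0 < d -> \forall N \near \oo, N%:R^-1 < d.
Proof.
move=> d0; near=> N.
have h : d^-1 < N%:R by near: N; exact: nbhs_infty_gtr.
by rewrite invf_plt// posrE; apply: lt_trans h; rewrite invr_gt0.
Unshelve. all: by end_near. Qed.

(** * Topology of the 1-complex: stars, segments and a Lebesgue number *)

Section GraphSpace.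
Variables (R : realType) (G : graph).
Implicit Types (e : gedge G) (v : gvert G) (x : gspace R G) (t : R).

Lemma gspace_openP (U : set (gspace R G)) :
  (forall e, open (chart e @^-1` U)) -> open U.
Proof. by move=> oU; change (gspace_open U). Qed.

Lemma chart_continuous e : continuous (chart e : R -> gspace R G).
Proof. by apply/continuousP => U oU; exact: oU. Qed.

Lemma chart_le0 e t : t <= 0 -> chart e t = inl (gsrc e).
Proof. by move=> t0; rewrite /chart insubF ?t0// ltNge t0. Qed.

Lemma chart_ge1 e t : 1 <= t -> chart e t = inl (gtgt e).
Proof.
move=> t1; rewrite /chart insubF; first by rewrite ifN// -ltNge (lt_le_trans _ t1).
by rewrite [t < 1]ltNge t1 andbF.
Qed.

Lemma chart_in e t (t01 : 0 < t < 1) : chart e t = inr (e, Sub t t01).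
Proof. by rewrite /chart insubT. Qed.

Lemma chart_val e (t : {t : R | 0 < t < 1}) : chart e (val t) = inr (e, t).
Proof. by rewrite (chart_in _ (valP t)); congr (inr (e, _)); exact: val_inj. Qed.

Lemma chart_itv e t : 0 < t < 1 \/ chart e t = inl (gsrc e) \/ chart e t = inl (gtgt e).
Proof.
have [t0|t0] := leP t 0; first by right; left; rewrite chart_le0.
by have [t1|t1] := leP 1 t; [right; right; rewrite chart_ge1|left].
Qed.

Lemma chart_inr e t e' (t' : {t : R | 0 < t < 1}) : chart e t = inr (e', t') -> e = e' /\ t = val t'.
Proof.
case: (leP t 0) => [t0|t0]; first by rewrite chart_le0.
case: (leP 1 t) => [t1|t1]; first by rewrite chart_ge1.
have t01 : 0 < t < 1 by rewrite t0.
by rewrite (chart_in _ t01) => -[-> <-].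
Qed.

Definition gpos x : R := if x is inr (_, t) then val t else 0.

Definition star v (r : R) : set (gspace R G) := fun x => match x with
  | inl u => u = v
  | inr (e, t) => (gsrc e = v /\ val t < r) \/ (gtgt e = v /\ 1 - r < val t) end.

Definition seg e (a b : R) : set (gspace R G) := fun x => match x with
  | inl _ => False
  | inr (e', t) => e' = e /\ a < val t < b end.

Lemma star_chart v r e t : 0 < r -> r <= 1 -> star v r (chart e t) <->
  (gsrc e = v /\ t < r) \/ (gtgt e = v /\ 1 - r < t).
Proof.
move=> r0 r1; have [t0|t0] := leP t 0.
  rewrite chart_le0//=; split=> [->|[[->]//|[_ ?]]]; last by exfalso; lra.
  by left; split => //; lra.
have [t1|t1] := leP 1 t.
  rewrite chart_ge1//=; split=> [->|[[_ ?]|[->]//]]; last by exfalso; lra.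
  by right; split => //; lra.
have t01 : 0 < t < 1 by rewrite t0.
by rewrite (chart_in _ t01).
Qed.

Lemma seg_chart e a b e' t : seg e a b (chart e' t) <->
  e' = e /\ (a < t < b /\ 0 < t < 1).
Proof.
have [t0|t0] := leP t 0; first by rewrite chart_le0//=; split => // -[_ []]; lra.
have [t1|t1] := leP 1 t; first by rewrite chart_ge1//=; split => // -[_ [_]]; lra.
have t01 : 0 < t < 1 by rewrite t0.
by rewrite (chart_in _ t01)/=; split => [[-> ->]|[-> [-> _]]].
Qed.

Lemma open_star v r : 0 < r -> r <= 1 -> open (star v r).
Proof.
move=> r0 r1; apply: gspace_openP => e.
have -> : chart e @^-1` star v r =
    [set t : R | gsrc e = v /\ t < r] `|` [set t : R | gtgt e = v /\ 1 - r < t].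
  by apply/seteqP; split => t /star_chart; apply.
apply: openU.
  have [->|ne] := eqVneq (gsrc e) v.
    rewrite (_ : mkset _ = [set t | t < r]); first exact: open_lt.
    by apply/seteqP; split => t; [case|split].
  rewrite (_ : mkset _ = set0); first exact: open0.
  by apply/seteqP; split => t // -[/eqP]; rewrite (negbTE ne).
have [->|ne] := eqVneq (gtgt e) v.
  rewrite (_ : mkset _ = [set t | 1 - r < t]); first exact: open_gt.
  by apply/seteqP; split => t; [case|split].
rewrite (_ : mkset _ = set0); first exact: open0.
by apply/seteqP; split => t // -[/eqP]; rewrite (negbTE ne).
Qed.

Lemma open_seg e a b : open (seg e a b).
Proof.
apply: gspace_openP => e'; have [->|ne] := eqVneq e' e.
  have -> : chart e @^-1` seg e a b = `]a, b[%classic `&` `]0, 1[%classic.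
    by apply/seteqP; split => t /=; rewrite !in_itv/=; [move=> /seg_chart[_]|move=> h; apply/seg_chart].
  by apply: openI; exact: itv_open.
rewrite (_ : _ @^-1` _ = set0); first exact: open0.
by apply/seteqP; split => t // /seg_chart[/eqP]; rewrite (negbTE ne).
Qed.

Lemma nbhs_star v r : 0 < r -> r <= 1 -> nbhs (inl v : gspace R G) (star v r).
Proof. by move=> r0 r1; apply: open_nbhs_nbhs; split => //; exact: open_star. Qed.

Lemma nbhs_seg e (t : {t : R | 0 < t < 1}) a b : a < val t < b ->
  nbhs (inr (e, t) : gspace R G) (seg e a b).
Proof. by move=> h; apply: open_nbhs_nbhs; split => //; exact: open_seg. Qed.

(* A small set is contained in a contractible piece of the graph, either near
   a vertex or in the interior of an edge. *)
Definition small (ep : R) (S : set (gspace R G)) : Prop :=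
  (exists v, S `<=` star v ep) \/ (exists e a, S `<=` seg e a (a + ep)).

Lemma small_nbhs ep x : 0 < ep -> ep <= 1 -> exists U, nbhs x U /\ small ep U.
Proof.
move=> ep0 ep1; case: x => [v|[e t]].
  by exists (star v ep); split; [exact: nbhs_star|left; exists v].
exists (seg e (val t - ep / 2) (val t - ep / 2 + ep)); split; last first.
  by right; exists e, (val t - ep / 2).
by apply: nbhs_seg; apply/andP; split; lra.
Qed.

Lemma gpos_continuous (X : topologicalType) (c : X -> gspace R G) e :
  continuous c -> (forall u, seg e 0 1 (c u)) -> continuous (gpos \o c).
Proof.
move=> cc ce u; apply/cvgrPdist_lt => ep ep0.
case cu : (c u) (ce u) => [//|[e' t]] [_ _] /=; rewrite cu /=.
have h : val t - ep < val t < val t + ep by apply/andP; split; lra.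
have := cc u _; rewrite cu => /(_ _ (nbhs_seg e' h)); rewrite /= nbhs_simpl/=.
apply: filterS => z /=; case: (c z) => [//|[e'' t'']] /= [_ /andP[? ?]].
by rewrite ltr_norml; apply/andP; split; lra.
Qed.

(** The topology is a quotient by the charts, and a product of quotient maps needs an argument. At a
    vertex only finitely many edge ends meet, so a single radius 1/N serves all of them. The second
    hypothesis accounts for a vertex that is the end of no edge. *)
Lemma gspace_prod_continuous (Y : topologicalType) (F : gspace R G * R -> Y) :
  (forall e, continuous (fun p : R * R => F (chart e p.1, p.2))) ->
  (forall v, continuous (fun s : R => F (inl v, s))) -> continuous F.
Proof.
move=> Fe Fv [x0 s0] U FU; rewrite nbhs_simpl/=; case: x0 FU => [v|[e t]] FU.
  have near_e e : \forall N \near \oo, \forall s \near s0,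
      (gsrc e = v -> forall t : R, `|0 - t| < N%:R^-1 -> U (F (chart e t, s))) /\
      (gtgt e = v -> forall t : R, `|1 - t| < N%:R^-1 -> U (F (chart e t, s))).
    have key (t0 : R) : chart e t0 = inl v -> \forall N \near \oo, \forall s \near s0,
        forall t : R, `|t0 - t| < N%:R^-1 -> U (F (chart e t, s)).
      move=> et0; have := Fe e (t0, s0); rewrite /= /continuous_at /= et0.
      move=> /(_ _ FU); rewrite nbhs_simpl/= => -[[A B]/= [At0 Bs0] AB].
      move: At0 => /nbhs_ballP[d /= d0 dA].
      near=> N; near=> s => t tr; apply: (AB (t, s)); split => /=.
        by apply: dA; rewrite /ball/=; apply: (lt_trans tr); near: N; exact: near_natinv_lt.
      by near: s.
    have k0 : gsrc e = v -> _ := fun h => key 0 (etrans (chart_le0 e (lexx 0)) (congr1 inl h)).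
    have k1 : gtgt e = v -> _ := fun h => key 1 (etrans (chart_ge1 e (lexx 1)) (congr1 inl h)).
    have [k0'|k0'] := pselect (gsrc e = v); have [k1'|k1'] := pselect (gtgt e = v).
    - move: (k0 k0') (k1 k1'); apply: filterS2 => N; apply: filterS2 => s h0 h1.
      by split=> _.
    - by move: (k0 k0'); apply: filterS => N; apply: filterS => s h0; split=> // /k1'.
    - by move: (k1 k1'); apply: filterS => N; apply: filterS => s h0; split=> // /k0'.
    by near=> N; near=> s; split=> [/k0'|/k1'].
  have near_all : \forall N \near \oo, \forall s \near s0, forall e,
      (gsrc e = v -> forall t : R, `|0 - t| < N%:R^-1 -> U (F (chart e t, s))) /\
      (gtgt e = v -> forall t : R, `|1 - t| < N%:R^-1 -> U (F (chart e t, s))).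
    have FN : Filter \oo by typeclasses eauto.
    have Fs : Filter (nbhs s0) by typeclasses eauto.
    have h := @filter_forall _ _ _ _ FN near_e.
    move: h; apply: filterS => N hr; have h := @filter_forall _ _ _ _ Fs hr; exact: h.
  near \oo => N.
  have N0 : (0 < N)%N by near: N; exact: nbhs_infty_gt.
  pose r : R := N%:R^-1.
  have r0 : 0 < r by rewrite invr_gt0 ltr0n.
  have r1 : r <= 1 by rewrite invf_le1 ?ltr0n// ler1n.
  have hs : \forall s \near s0, forall e,
      (gsrc e = v -> forall t : R, `|0 - t| < N%:R^-1 -> U (F (chart e t, s))) /\
      (gtgt e = v -> forall t : R, `|1 - t| < N%:R^-1 -> U (F (chart e t, s))) by near: N; exact: near_all.
  have hv : \forall s \near s0, U (F (inl v, s)) by exact: (Fv v s0 _ FU).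
  exists (star v r, [set s | (forall e,
      (gsrc e = v -> forall t : R, `|0 - t| < r -> U (F (chart e t, s))) /\
      (gtgt e = v -> forall t : R, `|1 - t| < r -> U (F (chart e t, s)))) /\ U (F (inl v, s))]).
    by split; [exact: nbhs_star|near=> s; split; near: s].
  move=> [[u|[e t]] s] /= [xs [hes hvs]]; first by rewrite [u]xs.
  have t01 := valP t; case/andP: t01 => t0 t1.
  have [h0 h1] := hes e; rewrite -chart_val.
  case: xs => -[ev tr]; change (sval t) with (val t) in tr; [apply: h0|apply: h1] => //;
  by rewrite -/r ltr_norml; clearbody r; apply/andP; split; lra.
have := Fe e (val t, s0) U; rewrite /= chart_val => /(_ FU); rewrite nbhs_simpl/=.
move=> -[[A B]/= [/nbhs_ballP[d /= d0 dA] Bs0] AB].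
exists (seg e (val t - d) (val t + d), B).
  by split => //; apply: nbhs_seg; apply/andP; split; lra.
move=> [[u|[e' t']] s] [sx Bs]; first by case: sx.
have [-> /andP[? ?]] : e' = e /\ val t - d < val t' < val t + d := sx.
have h : U (F (chart e (val t'), s)).
  apply: (AB (val t', s)); split => //.
  by apply: dA; change (`|val t - val t'| < d); rewrite ltr_norml; apply/andP; split; lra.
by rewrite chart_val in h.
Unshelve. all: by end_near. Qed.

(** The Lebesgue number of the unit square; periodicity brings any t0 into [0, 1]. H lives on the
    whole plane, so the small squares may stick out of the strip 0 <= s <= 1. *)
Lemma lebesgue_grid (ep : R) (H : R * R -> gspace R G) :
  0 < ep -> ep <= 1 -> continuous H -> (forall s, periodic1 (fun t => H (t, s))) ->
  \forall N \near \oo, forall t0 s0 : R, 0 <= s0 <= 1 ->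
    exists S, small ep S /\ forall t s, `|t0 - t| <= N%:R^-1 -> `|s0 - s| <= N%:R^-1 -> S (H (t, s)).
Proof.
move=> ep0 ep1 cH pH.
pose K : set (R * R) := `[0, 1]%classic `*` `[0, 1]%classic.
have cK : compact K by apply: compact_setX; exact: segment_compact.
pose P (N : nat) (z : R * R) := exists S, small ep S /\
  forall t s, `|z.1 - t| <= N%:R^-1 -> `|z.2 - s| <= N%:R^-1 -> S (H (t, s)).
have : \forall N \near \oo, K `<=` P N.
  move/compact_near_coveringP : cK; apply => z _.
  have [U [HU sU]] := small_nbhs (H z) ep0 ep1.
  have := cH z _ HU; rewrite nbhs_simpl/= => /nbhs_ballP[d /= d0 dU].
  have d20 : 0 < d / 2 by rewrite divr_gt0.
  exists (ball z (d / 2), [set N | N%:R^-1 < d / 2]).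
    split => /=; first exact: nbhsx_ballx.
    exact: (near_natinv_lt d20).
  move=> [z' N] /= [[z1 z2] hN]; exists U; split => // t s t1 s1.
  apply: dU; split; rewrite /ball/=; move: z1 z2; rewrite /ball/= => z1 z2.
    by rewrite (le_lt_trans (ler_distD z'.1 _ _))//; lra.
  by rewrite (le_lt_trans (ler_distD z'.2 _ _))//; lra.
apply: filterS => N KP t0 s0 s01.
have := real_floor_itv (num_real t0); rewrite intrD => /andP[? ?].
have [|S [sS hS]] := KP (t0 - (Num.floor t0)%:~R, s0).
  by split; rewrite /= in_itv//=; apply/andP; split; lra.
exists S; split=> // t s t1 s1; have := hS (t - (Num.floor t0)%:~R) s.
rewrite /= opprB addrA subrK => /(_ t1 s1).
by rewrite -(periodic1z (Num.floor t0) (t - _) (pH s)) subrK.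
Qed.

End GraphSpace.

Lemma cycle_nthP (T : Type) (r : rel T) (x0 : T) (w : seq T) :
  reflect (forall i, (i < size w)%N -> r (nth x0 w i) (nth x0 w (i.+1 %% size w))) (cycle r w).
Proof.
case: w => [|x p]; first by left.
have E1 i : (i < (size p).+1)%N -> nth x0 (x :: rcons p x) i = nth x0 (x :: p) i.
  by move=> ip; rewrite -rcons_cons nth_rcons /= ip.
have E2 i : (i < (size p).+1)%N ->
    nth x0 (rcons p x) i = nth x0 (x :: p) (i.+1 %% (size p).+1).
  rewrite nth_rcons ltnS leq_eqVlt => /predU1P[->|ip].
    by rewrite ltnn eqxx modnn.
  by rewrite ip modn_small.
apply: (iffP (pathP x0)) => /= h i ip.
  by rewrite -E1// -E2//; apply: h; rewrite size_rcons.
by rewrite size_rcons in ip; rewrite E1// E2//; exact: h.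
Qed.

Lemma cycle_rotN (T : Type) (r : rel T) (w : seq T) : (1 < size w)%N -> ~~ cycle r w ->
  exists i a b s, [/\ (i < size w)%N, rot i w = [:: a, b & s] & ~~ r a b].
Proof.
case: w => [//|x0 w0]; set w := x0 :: w0 => w1 /(cycle_nthP r x0)/existsNP[i].
move=> /not_implyP[iw /negP nr]; exists i, (nth x0 w i), (nth x0 w (i.+1 %% size w)).
rewrite /rot (drop_nth x0 iw).
have [iw'|] := ltnP i.+1 (size w).
  exists (drop i.+2 w ++ take i w); split=> //.
  by rewrite modn_small// (drop_nth x0 iw').
move=> wi; have {wi}wi : i.+1 = size w by apply/eqP; rewrite eqn_leq iw wi.
have i0 : (0 < i)%N by move: w1; rewrite -wi ltnS.
rewrite wi modnn in nr *; rewrite drop_size cat1s.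
case: i {wi} iw nr i0 => // k iw nr _.
by exists (take k w0).
Qed.

Lemma eq_glue (R : realType) (Y : Type) (N : nat) (P Q : nat -> R -> Y) : (0 < N)%N ->
  (forall j u, (j < N)%N -> 0 <= u < 1 -> P j u = Q j u) -> glue N P = glue N Q.
Proof.
move=> N0 PQ; apply/funext => t; have [n [j [x [jN x01 ->]]]] := glue_coord t N0.
by rewrite !glueE// PQ.
Qed.

(** * Existence of taut words *)

Section Taut.
Variables (R : realType) (G : graph).
Implicit Types (e : gedge G) (v : gvert G).
Local Notation gsp := (gspace R G).

(* At time 1, collapse carries the star of radius 1/4 of each vertex to that
   vertex, so a loop in small pieces becomes an edge path up to
   reparametrization. *)
Definition collapse (p : gsp * R) : gsp := match p.1 with
  | inl v => inl v
  | inr (e, t) => chart e (val t + `|p.2| * (val t - 1 / 2)) end.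

(** The edge is stretched about 1/2 by the factor 1 + |s| >= 1, so parameters beyond an end stay
    beyond it. The absolute value keeps this true for negative s. *)
Lemma collapse_chart e (t s : R) :
  collapse (chart e t, s) = chart e (t + `|s| * (t - 1 / 2)).
Proof.
have s0 := normr_ge0 s; have [t0|t0] := leP t 0.
  rewrite (chart_le0 e t0) chart_le0//.
  have : 0 <= `|s| * (1 / 2 - t) by rewrite mulr_ge0//; lra.
  by lra.
have [t1|t1] := leP 1 t.
  rewrite (chart_ge1 e t1) chart_ge1//.
  have : 0 <= `|s| * (t - 1 / 2) by rewrite mulr_ge0//; lra.
  by lra.
have t01 : 0 < t < 1 by rewrite t0.
by rewrite (chart_in e t01).
Qed.

Lemma collapse_continuous : continuous collapse.
Proof.
apply: gspace_prod_continuous => [e|v]; last first.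
  by move=> s; exact: cvg_cst.
have -> : (fun p : R * R => collapse (chart e p.1, p.2)) =
    fun p : R * R => chart e (p.1 + `|p.2| * (p.1 - 1 / 2)).
  by apply/funext => p; rewrite collapse_chart.
have c1 : continuous (fun p : R * R => p.1 + `|p.2| * (p.1 - 1 / 2)) by cont.
exact: (continuous_compT c1 (@chart_continuous R G e)).
Qed.

Lemma line_homotopic_collapse (c : R -> gsp) : continuous c -> periodic1 c ->
  line_homotopic c (fun t => collapse (c t, 1)).
Proof.
move=> cc pc; exists (fun p => collapse (c p.1, p.2)); split=> //.
- have c1 : continuous (fun p : R * R => (c p.1, p.2)).
    by apply: continuous_pairT; [apply: continuous_compT cc|]; cont.
  exact: (continuous_compT c1 collapse_continuous).
- by move=> s t /=; rewrite pc.
- move=> t; case: (c t) => [//|[e u]].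
  by rewrite -chart_val collapse_chart normr0 mul0r addr0.
Qed.

(** At time 1 the factor is 2, which sends 1/4 to 0 and 3/4 to 1; this is the origin of the radius
    1/4. *)
Lemma collapse_star v (x : gsp) : star v (1 / 4) x -> collapse (x, 1) = inl v.
Proof.
case: x => [u|[e t]] h; first by rewrite [u]h.
have {}h : star v (1 / 4) (chart e (val t)) by rewrite chart_val.
rewrite -chart_val collapse_chart normr1 mul1r.
have r0 : 0 < 1 / 4 :> R by lra.
have r1 : 1 / 4 <= 1 :> R by lra.
case: ((star_chart v e (val t) r0 r1).1 h) => -[<- ht]; first by rewrite chart_le0//; lra.
by rewrite chart_ge1//; lra.
Qed.

(* The letter (e, p, q) stands for the affine path in e from its end p to its
   end q, where false is the source; it is a constant path when p = q. *)
Definition letter : Type := (gedge G * bool * bool)%type.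
Definition lend e (b : bool) := if b then gtgt e else gsrc e.
Definition lsrc (a : letter) := lend a.1.1 a.1.2.
Definition ltgt (a : letter) := lend a.1.1 a.2.
Definition bR (b : bool) : R := if b then 1 else 0.
Definition lpath (a : letter) (u : R) : gsp :=
  chart a.1.1 (bR a.1.2 + (bR a.2 - bR a.1.2) * u).
Definition stutter (a : letter) := a.1.2 == a.2.
Definition lnext (a b : letter) := ltgt a == lsrc b.
Definition wloop (a0 : letter) (w : seq letter) : R -> gsp :=
  glue (size w) (fun j => lpath (nth a0 w j)).

Lemma chart_bR e b : chart e (bR b) = inl (lend e b).
Proof. by case: b; [exact: chart_ge1|exact: chart_le0]. Qed.

Lemma lpath0 a : lpath a 0 = inl (lsrc a).
Proof. by rewrite /lpath mulr0 addr0 chart_bR. Qed.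

Lemma lpath1 a : lpath a 1 = inl (ltgt a).
Proof. by rewrite /lpath mulr1 subrKC chart_bR. Qed.

Lemma lpath_continuous a : continuous (lpath a).
Proof.
have c1 : continuous (fun u : R => bR a.1.2 + (bR a.2 - bR a.1.2) * u).
  have cid : continuous (fun u : R => u) by move=> x; exact: cvg_id.
  by cont.
exact: (continuous_compT c1 (@chart_continuous R G _)).
Qed.

Lemma chart_clamp e (x : R) : chart e (clamp 0 1 x) = chart e x.
Proof.
have [x0|x0] := leP x 0.
  by rewrite !chart_le0// /clamp ge_max lexx ge_min x0.
have [x1|x1] := leP 1 x.
  by rewrite !chart_ge1// /clamp le_max le_min x1 lexx orbT.
by rewrite clamp_id// !ltW.
Qed.

Definition rnd (q : R) : bool := 1 <= q.

(** If the common point is interior to an edge, its two descriptions coincide; if it is a vertex,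
    both motions are constant because [rnd] preserves 0 and 1. So the end of one piece and the start
    of the next move together to a vertex. *)
Lemma rnd_interp e e' (q p s : R) : 0 <= q <= 1 -> 0 <= p <= 1 -> chart e q = chart e' p ->
  chart e ((1 - s) * q + s * bR (rnd q)) = chart e' ((1 - s) * p + s * bR (rnd p)).
Proof.
have key e1 (x : R) : 0 <= x <= 1 -> ~ (0 < x < 1) -> (1 - s) * x + s * bR (rnd x) = x.
  move=> x01 nx; have [->|x0] := eqVneq x 0.
    by rewrite /rnd ler10 /bR; lra.
  have -> : x = 1.
    have [//|x1] := eqVneq x 1.
    by case: nx; case/andP: x01 => ? ?; rewrite !lt_neqAle x1 eq_sym x0; apply/andP.
  by rewrite /rnd lexx /bR; lra.
move=> q01 p01 E; have [hq|hq] := pselect (0 < q < 1).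
  by move: (E); rewrite (chart_in e hq) => /esym/chart_inr[-> ->].
have [hp|hp] := pselect (0 < p < 1).
  by move: (E); rewrite (chart_in e' hp) => /chart_inr[-> ->].
by rewrite !key.
Qed.

(** After collapsing, each of the N short arcs of c lies in one closed edge: an arc in a star has
    become constant, an arc in a segment has a continuous edge parameter. It is then straightened
    inside its chart while its ends are rounded to vertices. The incidence hypothesis provides an
    edge to carry an arc that is constant at a vertex. *)
Lemma discretize (a0 : letter) (c : R -> gsp) : continuous c -> periodic1 c ->
  (forall v, exists e b, lend e b = v) ->
  exists w, [/\ (0 < size w)%N, cycle lnext w & line_homotopic c (wloop a0 w)].
Proof.
move=> cc pc inc.
have e40 : 0 < 1 / 4 :> R by lra.
have e41 : 1 / 4 <= 1 :> R by lra.
have cH : continuous (fun p : R * R => c p.1).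
  exact: (continuous_compT (@continuous_fstT R R) cc).
have := lebesgue_grid e40 e41 cH (fun _ => pc); move=> HN.
near \oo => N.
have N0 : (0 < N)%N by near: N; exact: nbhs_infty_gt.
have hN : forall t0 s0 : R, 0 <= s0 <= 1 ->
    exists S, small (1 / 4) S /\ forall t s : R, `|t0 - t| <= N%:R^-1 -> `|s0 - s| <= N%:R^-1 -> S (c t).
  by near: N; exact: HN.
have NR0 : 0 < N%:R :> R by rewrite ltr0n.
pose c1 t := collapse (c t, 1).
have pc1 : periodic1 c1 by move=> t; rewrite /c1 pc.
have pieces (j : nat) : exists ex : gedge G * (R -> R), continuous ex.2 /\
    forall u, 0 <= u <= 1 -> c1 ((j%:R + u) / N%:R) = chart ex.1 (ex.2 u).
  have [|S [sS hS]] := hN (j%:R / N%:R) 0; first by rewrite lexx ler01.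
  have Sc u : 0 <= u <= 1 -> S (c ((j%:R + u) / N%:R)).
    move=> /andP[u0 u1]; apply: (hS _ 0); last by rewrite subrr normr0 invr_ge0 ltW.
    rewrite mulrDl opprD addrA subrr add0r normrN ger0_norm; last first.
      by rewrite mulr_ge0// invr_ge0 ltW.
    by rewrite -[leRHS]mul1r ler_pM2r ?invr_gt0.
  case: sS => [[v Sv]|[e [a Sa]]].
    have [e [b eb]] := inc v.
    exists (@pair (gedge G) (R -> R) e (fun _ : R => bR b)); split=> /=; first exact: continuous_cstT.
    by move=> u u01; rewrite chart_bR eb; apply: collapse_star; apply: Sv; exact: Sc.
  (* The arc is controlled only for u in [0, 1]; clamping makes y continuous on the whole line. *)
  pose y (u : R) := gpos (c ((j%:R + clamp 0 1 u) / N%:R)).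
  have cy : continuous y.
    have c2 : continuous (fun u : R => c ((j%:R + clamp 0 1 u) / N%:R)).
      have := @clamp_continuous R 0 1 => ccl.
      have c3 : continuous (fun u : R => (j%:R + clamp 0 1 u) / N%:R) by cont.
      exact: (continuous_compT c3 cc).
    apply: (gpos_continuous c2 (e := e)) => u.
    have := Sa _ (Sc _ (clamp_itv u ler01)).
    by case: (c _) => // -[e1 t] [-> _]; split=> //; exact: (valP t).
  exists (@pair (gedge G) (R -> R) e (fun u => y u + (y u - 1 / 2))); split=> /=; first by cont.
  move=> u u01; rewrite /c1 /y clamp_id//.
  have := Sa _ (Sc _ u01); case: (c _) => // -[e' t] [-> _].
  by rewrite -chart_val collapse_chart normr1 mul1r chart_val.
have [ex hex] := choice pieces.
pose ed j := (ex j).1; pose x j := (ex j).2.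
have cx j : continuous (x j) by exact: (hex j).1.
have c1E j u : 0 <= u <= 1 -> c1 ((j%:R + u) / N%:R) = chart (ed j) (x j u).
  exact: (hex j).2.
pose X j u := clamp 0 1 (x j u).
have X01 j u : 0 <= X j u <= 1 by exact: clamp_itv.
have cX j : continuous (X j) by exact: (continuous_compT (cx j) (@clamp_continuous R 0 1)).
pose L j : letter := (ed j, rnd (X j 0), rnd (X j 1)).
pose P j (p : R * R) := chart (ed j) ((1 - p.2) * X j p.1 +
   p.2 * (bR (rnd (X j 0)) + (bR (rnd (X j 1)) - bR (rnd (X j 0))) * p.1)).
have match_ j : (j < N)%N -> chart (ed j) (X j 1) = chart (ed (j.+1 %% N)%N) (X (j.+1 %% N)%N 0).
  move=> jN; rewrite !chart_clamp -!c1E ?lexx ?ler01//.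
  have [jN'|] := ltnP j.+1 N; first by rewrite modn_small// natr1 addr0.
  move=> Nj; have -> : N = j.+1 by apply/eqP; rewrite eqn_leq jN Nj.
  by rewrite modnn natr1 divff ?pnatr_eq0// addr0 mul0r -[in LHS](add0r 1) pc1.
have PP j s : (j < N)%N -> P j (1, s) = P (j.+1 %% N)%N (0, s).
  move=> jN; rewrite /P /= mulr1 mulr0 addr0 subrKC.
  by apply: rnd_interp => //; exact: match_.
have P1 j u : P j (u, 1) = lpath (L j) u.
  by rewrite /P/= subrr mul0r add0r mul1r.
exists (mkseq L N); rewrite size_mkseq; split => //.
  apply/(cycle_nthP _ a0) => j; rewrite size_mkseq => jN.
  have jN' : (j.+1 %% N < N)%N by rewrite ltn_mod.
  rewrite !nth_mkseq//; apply/eqP.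
  have := PP j 1 jN; rewrite !P1 lpath1 lpath0 => -[].
  by [].
apply: (line_homotopic_trans (line_homotopic_collapse cc pc)).
have cP j : (j < N)%N -> continuous (P j).
  move=> _; have c2 : continuous (fun p : R * R => X j p.1).
    by apply: continuous_compT; [cont|exact: cX].
  apply: continuous_compT; last exact: chart_continuous.
  by cont.
have := line_homotopic_glue N0 cP PP.
have -> : glue N (fun j u => P j (u, 0)) = c1.
  apply/funext => t; have [n [j [u [jN u01 ->]]]] := glue_coord t N0.
  rewrite glueE// /P /= subr0 mul1r mul0r addr0 chart_clamp -c1E; last first.
    by case/andP: u01 => -> /ltW ->.
  by rewrite (addrC n%:~R) (periodic1z n _ pc1).
have -> // : glue N (fun j u => P j (u, 1)) = wloop a0 (mkseq L N).
rewrite /wloop size_mkseq; apply: eq_glue => // j u jN u01.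
by rewrite P1 nth_mkseq.
Unshelve. all: by end_near. Qed.

Implicit Types (a b x : letter) (w : seq letter).

Lemma lpath_match a0 w j : cycle lnext w -> (j < size w)%N ->
  lpath (nth a0 w j) 1 = lpath (nth a0 w (j.+1 %% size w)%N) 0.
Proof.
by move=> /(cycle_nthP _ a0) h /h /eqP E; rewrite lpath1 lpath0 E.
Qed.

Lemma wloop_continuous a0 w : (0 < size w)%N -> cycle lnext w -> continuous (wloop a0 w).
Proof.
move=> w0 cw; apply: continuous_glue => // [j _|j jw]; first exact: lpath_continuous.
exact: lpath_match.
Qed.

Lemma wloopE a0 w (n : int) (j : nat) (u : R) : cycle lnext w -> (j < size w)%N -> 0 <= u <= 1 ->
  wloop a0 w (n%:~R + (j%:R + u) / (size w)%:R) = lpath (nth a0 w j) u.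
Proof.
move=> cw jw u01; rewrite /wloop glueE1// => i iw.
exact: lpath_match.
Qed.

(** Rotation of the word shifts the parameter of the loop by one piece. *)
Lemma line_homotopic_rot1 a0 w : (0 < size w)%N -> cycle lnext w ->
  line_homotopic (wloop a0 w) (wloop a0 (rot 1 w)).
Proof.
move=> w0 cw; apply: line_homotopic_sym.
have -> : wloop a0 (rot 1 w) = wloop a0 w \o (fun t => t + 1 / (size w)%:R).
  apply/funext => t; have [n [j [u [jw u01 ->]]]] := glue_coord t w0.
  have NR0 : (size w)%:R != 0 :> R by rewrite pnatr_eq0 -lt0n.
  have u01' : 0 <= u <= 1 by case/andP: u01 => -> /ltW.
  rewrite -[in LHS](size_rot 1 w) wloopE ?rot_cycle ?size_rot//=.
  rewrite -addrA -mulrDl addrAC natr1.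
  case: w w0 cw jw {NR0} => // a w _ cw; rewrite rot1_cons/= ltnS leq_eqVlt => /predU1P[->|jw].
    rewrite nth_rcons ltnn eqxx.
    have -> : n%:~R + ((size w).+1%:R + u) / (size w).+1%:R = (n + 1)%:~R + (0%:R + u) / (size w).+1%:R :> R.
      by rewrite mulrDl divff ?pnatr_eq0// add0r intrD addrA.
    by rewrite (@wloopE a0 (a :: w)).
  by rewrite nth_rcons jw (@wloopE a0 (a :: w)).
apply: line_homotopic_reparam.
- exact: wloop_continuous.
- exact: glue_periodic.
- have cid : continuous (fun t : R => t) by move=> t; exact: cvg_id.
  by cont.
- by move=> t; rewrite addrAC.
Qed.

Lemma line_homotopic_rot a0 w i : (0 < size w)%N -> cycle lnext w -> (i < size w)%N ->
  line_homotopic (wloop a0 w) (wloop a0 (rot i w)).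
Proof.
move=> w0 cw; elim: i => [|i IH] iw.
  rewrite rot0; apply: line_homotopic_refl; [exact: wloop_continuous|exact: glue_periodic].
apply: (line_homotopic_trans (IH (ltnW iw))).
rewrite rotS; last exact: ltnW.
by apply: line_homotopic_rot1; rewrite ?size_rot ?rot_cycle.
Qed.

Lemma cycle_drop_stutter x y w : stutter x -> cycle lnext [:: x, y & w] -> cycle lnext (y :: w).
Proof.
move=> /eqP sx /= /andP[/eqP xy]; rewrite !rcons_path => /andP[-> /=] /eqP wx.
by apply/eqP; rewrite wx -xy /lsrc /ltgt sx.
Qed.

(** The longer loop is the shorter one composed with a map of degree one that stands still during
    the constant letter x. *)
Lemma line_homotopic_drop_stutter a0 x y w : stutter x -> cycle lnext [:: x, y & w] ->
  line_homotopic (wloop a0 [:: x, y & w]) (wloop a0 (y :: w)).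
Proof.
move=> sx cw; have cw' := cycle_drop_stutter sx cw.
pose n := (size w).+1.
have n0 : n%:R != 0 :> R by rewrite pnatr_eq0.
have n1 : n.+1%:R != 0 :> R by rewrite pnatr_eq0.
(* [rho] rests during piece 0 and runs through the n pieces of the shorter loop during the others.
   Its displacement d = rho - id is periodic, which makes it a glued function. *)
pose d (j : nat) (u : R) : R := if j is i.+1 then (i%:R + u) / n%:R - (i.+1%:R + u) / n.+1%:R
  else 0 - u / n.+1%:R.
pose rho (t : R) := t + glue n.+1 d t.
have dd j : (j < n.+1)%N -> d j 1 = d (j.+1 %% n.+1)%N 0.
  rewrite ltnS leq_eqVlt => /predU1P[->|jn].
    by rewrite modnn /d /n !natr1 -/n !divff// subrr mul0r subr0.
  rewrite modn_small//; case: j jn => [|j] jn /=.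
    by rewrite addr0 mul0r addr0.
  by rewrite !natr1 !addr0.
have rhoE (m : int) (j : nat) (u : R) : (j < n.+1)%N -> 0 <= u < 1 ->
    rho (m%:~R + (j%:R + u) / n.+1%:R) = if j is i.+1 then m%:~R + (i%:R + u) / n%:R else m%:~R.
  move=> jn u01; rewrite /rho glueE//; case: j jn => [|j] jn /=.
    by rewrite add0r sub0r addrK.
  by move: ((j%:R + u) / n%:R) ((j.+1%:R + u) / n.+1%:R) => p q; ring.
have -> : wloop a0 [:: x, y & w] = wloop a0 (y :: w) \o rho.
  apply/funext => t; have [m [j [u [jn u01 ->]]]] := glue_coord t (ltn0Sn n).
  have u01' : 0 <= u <= 1 by case/andP: u01 => -> /ltW.
  rewrite (@wloopE a0 [:: x, y & w])//= rhoE//; case: j jn => [|j] jn /=.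
    have := @wloopE a0 (y :: w) m 0%N 0 cw' isT; rewrite lexx ler01 addr0 mul0r addr0 => ->//.
    rewrite /= lpath0; move: cw => /= /andP[/eqP <- _].
    by rewrite -lpath1 /lpath (eqP sx) subrr !mul0r.
  by rewrite (@wloopE a0 (y :: w)).
apply: line_homotopic_reparam.
- exact: wloop_continuous.
- exact: glue_periodic.
- have cid : continuous (fun t : R => t) by move=> t; exact: cvg_id.
  have cd : continuous (glue n.+1 d).
    by apply: continuous_glue => // -[|j] _ /=; cont.
  by rewrite /rho; cont.
- by move=> t; rewrite /rho (glue_periodic n.+1 d t) addrAC.
Qed.

Definition backtrack a b := b == (a.1.1, a.2, a.1.2).

(** The spur is contracted to its starting vertex. This leaves two constant letters, so the number
    of pieces does not change during the homotopy; shortening is left to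
    [line_homotopic_drop_stutter]. *)
Lemma line_homotopic_backtrack a0 a b w : backtrack a b -> cycle lnext [:: a, b & w] ->
  let s := (a.1.1, a.1.2, a.1.2) : letter in
  cycle lnext [:: s, s & w] /\
  line_homotopic (wloop a0 [:: a, b & w]) (wloop a0 [:: s, s & w]).
Proof.
case: a => -[e p] q /eqP -> /= cw; pose s : letter := (e, p, p).
have cs : cycle lnext [:: s, s & w].
  have ss : lnext s s by rewrite /lnext.
  move/andP: cw => [_]; rewrite /= ss /=; case: w => [|c w] //=; rewrite !rcons_path.
  by move=> /andP[h1 /andP[h2 h3]]; apply/and3P.
split; first exact: cs.
pose W : seq letter := [:: (e, p, q), (e, q, p) & w].
pose W' : seq letter := [:: s, s & w].
change (line_homotopic (wloop a0 W) (wloop a0 W')).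
pose P j (z : R * R) := match j with
 | 0%N => chart e (bR p + (1 - z.2) * ((bR q - bR p) * z.1))
 | 1%N => chart e (bR p + (1 - z.2) * ((bR q - bR p) * (1 - z.1)))
 | _ => lpath (nth a0 W j) z.1 end.
have P0 j u : P j (u, 0) = lpath (nth a0 W j) u.
  case: j => [|[|j]] //=; rewrite subr0 mul1r /lpath //=.
  by congr (chart e _); ring.
have P1 j u : P j (u, 1) = lpath (nth a0 W' j) u.
  by case: j => [|[|j]] //=; rewrite subrr mul0r /lpath /= subrr mul0r.
have := @line_homotopic_glue R gsp (size W) P isT.
have -> : glue (size W) (fun j u => P j (u, 0)) = wloop a0 W.
  by apply: eq_glue => // j u _ _; rewrite P0.
have -> : glue (size W) (fun j u => P j (u, 1)) = wloop a0 W'.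
  by apply: (@eq_glue R _ (size W)) => // j u _ _; rewrite P1.
apply=> [j _|j z jW].
  case: j => [|[|j]] /=; [|  |].
  - apply: continuous_compT; last exact: chart_continuous.
    by cont.
  - apply: continuous_compT; last exact: chart_continuous.
    by cont.
  - apply: continuous_compT; last exact: lpath_continuous.
    by cont.
case: j jW => [|j] jW.
  by rewrite modn_small//= mulr1 subr0 mulr1.
have -> : P j.+1 (1, z) = lpath (nth a0 W j.+1) 1.
  by case: j jW => [|j] _ //=; rewrite subrr !mulr0 addr0 lpath1 chart_bR.
have -> : P (j.+2 %% size W)%N (0, z) = lpath (nth a0 W (j.+2 %% size W)%N) 0.
  have [j2|j2] := ltnP j.+2 (size W); first by rewrite modn_small.
  have -> : j.+2 = size W by apply/eqP; rewrite eqn_leq jW j2.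
  by rewrite modnn /= !mulr0 addr0 lpath0 chart_bR.
exact: lpath_match.
Qed.

Definition to_oedge a : gedge G * bool := (a.1.1, a.2).

Lemma lpath_ochart a u : ~~ stutter a -> lpath a u = ochart (to_oedge a) u.
Proof.
case: a => -[e p] q; rewrite /stutter /lpath /ochart /=.
by case: p; case: q => //= _; congr (chart e _); rewrite /bR; ring.
Qed.

(** Induction on the length: a constant letter or a cyclic backtracking is rotated to the front, and
    one letter is removed. When neither occurs, the letters are oriented edges and form a
    nonbacktracking word. *)
Lemma reduce_word a0 w : (0 < size w)%N -> cycle lnext w ->
  exists w' : seq (gedge G * bool), taut_word (wloop a0 w) w'.
Proof.
move: {2}(size w) (leqnn (size w)) => n; elim: n w => [|n IH] w wn w0 cw.
  by rewrite leqn0 in wn; rewrite (eqP wn) in w0.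
have via w1 : (0 < size w1)%N -> (size w1 <= n)%N -> cycle lnext w1 ->
    line_homotopic (wloop a0 w) (wloop a0 w1) -> exists o : seq (gedge G * bool), taut_word (wloop a0 w) o.
  move=> w10 w1n cw1 ww1; have [w' hw'] := IH w1 w1n w10 cw1; exists w'.
  case: w' hw' => [[p hp]|a w' [nb hw']].
    exists p; apply/line_homotopicP; apply: (line_homotopic_trans ww1).
    exact/line_homotopicP.
  split=> //; apply/line_homotopicP; apply: (line_homotopic_trans ww1).
  exact/line_homotopicP.
have dropst w1 x y s : w1 = [:: x, y & s] -> stutter x -> size w1 = size w -> cycle lnext w1 ->
    line_homotopic (wloop a0 w) (wloop a0 w1) -> exists o : seq (gedge G * bool), taut_word (wloop a0 w) o.
  move=> -> sx w1w cw1 ww1; apply: (via (y :: s)) => //.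
  - by move: wn; rewrite -w1w.
  - exact: cycle_drop_stutter cw1.
  - exact: (line_homotopic_trans ww1 (line_homotopic_drop_stutter a0 sx cw1)).
(* A single letter cannot be dropped by the general argument. If constant, it gives the empty taut
   word; otherwise it is a self-loop, which is never its own reverse. *)
have [w1|w1] := leqP (size w) 1.
  case: w w0 w1 cw {wn via dropst} => // a [|//] _ _ cw.
  have [sa|sa] := boolP (stutter a).
    exists [::]; exists (lpath a 0); apply/line_homotopicP.
    have -> : wloop a0 [:: a] = fun=> lpath a 0.
      apply/funext => t; have [m [j [u [jn u01 ->]]]] := glue_coord t (ltn0Sn 0).
      rewrite /wloop glueE//; case: j jn => // _.
      by rewrite /lpath (eqP sa) subrr !mul0r.
    by apply: line_homotopic_refl => // t; exact: cvg_cst.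
  exists [:: to_oedge a]; split.
    rewrite /nonbacktracking /= andbT; case: (a) cw sa => -[e p] q.
    rewrite /lnext /= andbT /stutter /otgt /osrc /lsrc /ltgt /orev /to_oedge /=.
    by move=> /eqP; rewrite /lend; case: p; case: q => //= -> _; rewrite eqxx xpair_eqE andbF.
  apply/line_homotopicP.
  have -> : edge_loop (to_oedge a) [::] = wloop a0 [:: a].
    apply: (@eq_glue R gsp 1 (fun j => ochart (nth (to_oedge a) [:: to_oedge a] j))
      (fun j => lpath (nth a0 [:: a] j))) => // j u.
    by case: j => // _ _; rewrite lpath_ochart.
  by apply: line_homotopic_refl; [exact: wloop_continuous|exact: glue_periodic].
have [/hasP[x xw sx]|nst] := boolP (has stutter w).
  have iw : (index x w < size w)%N by rewrite index_mem.
  have hrot := line_homotopic_rot a0 w0 cw iw.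
  have crot : cycle lnext (rot (index x w) w) by rewrite rot_cycle.
  have srot := size_rot (index x w) w.
  case E : (rot _ w) hrot crot srot => [|x' [|y s]] hrot crot srot.
  - by move: w1; rewrite -srot.
  - by move: w1; rewrite -srot.
  have x'x : x' = x by move: (rot_index xw); rewrite /= E => -[].
  by apply: (dropst _ _ _ _ erefl _ srot crot hrot); rewrite x'x.
have [good|] := boolP (cycle (fun a b => lnext a b && ~~ backtrack a b) w); last first.
  move=> /(cycle_rotN w1)[i [a [b [s [iw E nab]]]]].
  have := line_homotopic_rot a0 w0 cw iw.
  have : cycle lnext (rot i w) by rewrite rot_cycle.
  rewrite E => cab hab.
  have bab : backtrack a b by move: nab; rewrite negb_and negbK; case/orP => //; move: cab => /= /andP[->].
  have [cs hs] := line_homotopic_backtrack a0 bab cab.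
  apply: (dropst _ _ _ _ erefl _ _ cs (line_homotopic_trans hab hs)); first exact: eqxx.
  by rewrite -(size_rot i w) E.
have nstE i : (i < size w)%N -> ~~ stutter (nth a0 w i).
  by move=> iw; apply: contra nst => si; apply/hasP; exists (nth a0 w i) => //; exact: mem_nth.
have nb : nonbacktracking (map to_oedge w).
  apply/(cycle_nthP _ (to_oedge a0)) => i; rewrite size_map => iw.
  have iw' : (i.+1 %% size w < size w)%N by rewrite ltn_mod.
  rewrite !(nth_map a0)//; have := nstE _ iw; have := nstE _ iw'.
  move/(cycle_nthP _ a0)/(_ i iw) : good.
  case: (nth a0 w i) => -[e p] q; case: (nth a0 w _) => -[e' p'] q'.
  rewrite /lnext /backtrack /stutter /otgt /osrc /lsrc /ltgt /orev /to_oedge /=.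
  rewrite /lend => /andP[/eqP h1 h2] h3 h4; apply/andP; split.
    by apply/eqP; move: h1 h3 h4 {h2}; case: p; case: q; case: p'; case: q'.
  apply: contra h2 => /eqP[ee qq]; move: h3 h4 {h1}; rewrite ee qq {ee qq}.
  by case: p; case: q; case: p' => //= _ _; rewrite ?eqxx.
have hl (o : gedge G * bool) (w' : seq (gedge G * bool)) :
    map to_oedge w = o :: w' -> wloop a0 w = edge_loop o w'.
  move=> E; have sw : size w = (size w').+1 by rewrite -(size_map to_oedge) E.
  rewrite /wloop sw.
  apply: (@eq_glue R gsp (size w').+1 (fun j => lpath (nth a0 w j))
    (fun j => ochart (nth o (o :: w') j))) => // j u jw _.
  by rewrite -sw in jw; rewrite -E (nth_map a0)// lpath_ochart// nstE.
exists (map to_oedge w); case E: (map _ w) nb => [|a w'] nb.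
  by move: (size_map to_oedge w) w0; rewrite E => <-.
split=> //; apply/line_homotopicP; rewrite -(hl a w' E).
by apply: line_homotopic_refl; [exact: wloop_continuous|exact: glue_periodic].
Qed.

Lemma exists_incident_edge (v : gvert G) : (0 < #|gedge G|)%N -> exists e (b : bool), lend e b = v.
Proof.
move=> /card_gt0P[e0 _].
have /connectP[p] := gconnected v (gsrc e0).
case: p => [_ /= E|u p /= /andP[/existsP[e he] _] _]; first by exists e0, false.
by case/orP: he => /andP[/eqP h1 /eqP h2]; [exists e, false|exists e, true].
Qed.

(** A graph without edges offers no letter to [discretize]; by connectedness it is a single
    point. *)
Lemma exists_taut_word (c : R -> gsp) : continuous c -> periodic1 c ->
  exists w : seq (gedge G * bool), taut_word c w.
Proof.
move=> cc pc; case: (posnP #|gedge G|) => [G0|G0].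
  have noedge (e : gedge G) : False by move/card0_eq: G0 => /(_ e).
  have /card_gt0P[v0 _] := gvert_gt0 G.
  exists [::]; exists (inl v0); apply/line_homotopicP.
  have -> : c = fun=> inl v0.
    apply/funext => t; case: (c t) => [v|[e s]]; last by case: (noedge e).
    have /connectP[p] := gconnected v0 v; case: p => [_ /= -> //|u p /= /andP[/existsP[e _]]].
    by case: (noedge e).
  by apply: line_homotopic_refl => // t; exact: cvg_cst.
have /card_gt0P[e0 _] := G0.
pose a0 : letter := (e0, false, false).
have [w [w0 cw cwl]] := discretize a0 cc pc (fun v => exists_incident_edge v G0).
have [w' hw'] := reduce_word a0 w0 cw; exists w'.
case: w' hw' => [[p hp]|a w' [nb hw']].
  by exists p; apply/line_homotopicP; apply: (line_homotopic_trans cwl); exact/line_homotopicP.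
by split=> //; apply/line_homotopicP; apply: (line_homotopic_trans cwl); exact/line_homotopicP.
Qed.

End Taut.

(** * Crossing words *)

Lemma sum_word (R : realType) (G : graph) (F : gedge G -> R) (w : seq (gedge G * bool)) :
  \sum_(b <- w) F b.1 = \sum_e F e * (count (fun a => a.1 == e) w)%:R.
Proof.
elim: w => [|b w IH]; first by rewrite big_nil big1// => e _; rewrite mulr0.
rewrite big_cons IH (bigD1 b.1)//= [RHS](bigD1 b.1)//= addrA; congr (_ + _).
  by rewrite eqxx natrD mulrDr mulr1.
by apply: eq_bigr => e eb; rewrite eq_sym (negbTE eb).
Qed.

(** * Reduced words in the free group on the edges *)

Section FreeReduction.
Variable G : graph.
Implicit Types (a b : gedge G * bool) (s w d : seq (gedge G * bool)) (e : gedge G).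
Local Notation orev := (@orev G).

Definition noncancel a b : bool := b != orev a.
(** The free group is represented by its action on reduced words, kept as stacks with the last
    letter on top: a letter is pushed, or cancels the top. Equalities in the group become equalities
    between actions. *)
Definition act s a := if s is b :: s' then if b == orev a then s' else a :: s else [:: a].
Definition acts s w := foldl act s w.
Definition reduced s := sorted noncancel s.
Definition inv_word w := map orev (rev w).
Definition ecount e w := count (fun a => a.1 == e) w.

Lemma orevK : involutive orev.
Proof. by case=> e b; rewrite /Defs.orev /= negbK. Qed.

Lemma noncancel_sym a b : noncancel a b = noncancel b a.
Proof. by rewrite /noncancel; congr (~~ _); apply/eqP/eqP => ->; rewrite orevK. Qed.

Lemma act_reduced s a : reduced s -> reduced (act s a).
Proof.
case: s => //= b s; case: eqP => [_|/eqP ba] rs; first by case: s rs => //= c s /andP[].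
by rewrite /= /noncancel ba.
Qed.

Lemma actK s a : reduced s -> act (act s a) (orev a) = s.
Proof.
case: s => [|b s] /=; first by rewrite orevK eqxx.
case: eqP => [->|_]; last by rewrite /= orevK eqxx.
case: s => //= c s /andP[]; rewrite /noncancel orevK => /negbTE ->.
by [].
Qed.

Lemma acts_reduced s w : reduced s -> reduced (acts s w).
Proof. by elim: w s => //= a w IH s rs; apply: IH; exact: act_reduced. Qed.

Lemma acts_cat s w w' : acts s (w ++ w') = acts (acts s w) w'.
Proof. exact: foldl_cat. Qed.

Lemma actsK s w : reduced s -> acts (acts s w) (inv_word w) = s.
Proof.
elim: w s => // a w IH s rs; rewrite /inv_word rev_cons map_rcons -cats1 acts_cat /=.
by rewrite -/(inv_word w) IH ?act_reduced// actK.
Qed.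

Lemma inv_wordK : involutive inv_word.
Proof. by move=> w; rewrite /inv_word -map_rev revK -map_comp map_id_in// => a _ /=; rewrite orevK. Qed.

Lemma ecount_acts e s w : (ecount e (acts s w) <= ecount e s + ecount e w)%N.
Proof.
elim: w s => [|a w IH] s; first by rewrite addn0.
apply: (leq_trans (IH _)); rewrite /ecount /= addnA leq_add2r.
by case: s => [|b s] /=; [rewrite addn0|case: ifP => _ /=; lia].
Qed.

Lemma acts_nil_reduced w : reduced w -> acts [::] w = rev w.
Proof.
elim/last_ind: w => // w a IH rwa.
have rw : reduced w by move: rwa; rewrite /reduced -cats1 => /cat_sorted2[].
rewrite -cats1 acts_cat IH// cats1 rev_rcons /=.
case/lastP: w rwa {IH rw} => // w b; rewrite rev_rcons /= /reduced -!cats1 -catA /=.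
move=> /cat_sorted2[_] /= /andP[+ _]; rewrite noncancel_sym /noncancel.
by move=> /negbTE ->.
Qed.

Lemma reduced_power w m : cycle noncancel w -> reduced (flatten (nseq m w)).
Proof.
case: w => [|a w] cw; first by elim: m.
suff H : forall m, path noncancel (last a w) (flatten (nseq m (a :: w))).
  by case: m => // m; have := H m.+1; rewrite /reduced /=; case/andP.
move: cw; rewrite /= rcons_path => /andP[pw lw].
by elim=> // k IH; rewrite /= lw /= cat_path pw.
Qed.

Lemma ecount_power e w m : ecount e (flatten (nseq m w)) = (m * ecount e w)%N.
Proof. by elim: m => // m IH; rewrite /ecount /= count_cat mulSn; congr (_ + _)%N. Qed.

(* In long powers the conjugating word d becomes negligible, so the cyclically
   reduced word z uses each edge least often in its conjugacy class. *)
Lemma conj_ecount e y z d :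
  (forall m s, reduced s ->
     acts (acts s (flatten (nseq m y))) d = acts (acts s d) (flatten (nseq m z))) ->
  cycle noncancel z -> (ecount e z <= ecount e y)%N.
Proof.
move=> H cz; rewrite leqNgt; apply/negP => lt_yz.
(* This s represents the inverse of d, so the right side of [H] is the k-th power of z itself,
   already reduced. An excess of one letter per copy exceeds, after k copies, what s and d can
   contribute. *)
pose s := acts [::] (inv_word d); have rs : reduced s by exact: acts_reduced.
pose k := (ecount e s + ecount e d).+1.
have := H k s rs; have -> : acts s d = [::] by rewrite /s -{2}(inv_wordK d) actsK.
rewrite acts_nil_reduced ?reduced_power// => E.
have := ecount_acts e (acts s (flatten (nseq k y))) d; rewrite E.
rewrite /ecount count_rev -!/(ecount _ _) ecount_power.
have := ecount_acts e s (flatten (nseq k y)); rewrite ecount_power.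
move: lt_yz; rewrite /k; move: (ecount e s) (ecount e d) (ecount e y) (ecount e z) (ecount e _) => p q u v r.
by nia.
Qed.

End FreeReduction.

(** * Letters read off sampled paths *)

Section Crossings.
Variables (R : realType) (G : graph).
Implicit Types (e : gedge G) (v : gvert G) (x y z : gspace R G).

(* The letter spelled by a short path from x to y when it crosses the points
   of parameter th of the edges. The bound 1/2 only discards pairs of points
   which are close through a vertex. *)
Definition cross (th : R) x y : seq (gedge G * bool) := match x, y with
  | inr (e, t), inr (e', t') =>
    if (e == e') && (`|val t - val t'| < 1 / 2) then
      if val t < th <= val t' then [:: (e, true)]
      else if val t' < th <= val t then [:: (e, false)] else [::]
    else [::]
  | _, _ => [::] end.

(** Two points of a star on the same edge and on opposite sides of th lie near opposite ends of a
    self-loop. Since ep < 1/4, their parameters differ by more than 1/2, and [cross] discards the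
    pair. *)
Lemma cross_star th ep v x y : ep <= th -> th <= 1 - ep -> ep < 1 / 4 ->
  star v ep x -> star v ep y -> cross th x y = [::].
Proof.
case: x => [//|[e t]]; case: y => [//|[e' t']] h1 h2 h3 hx hy /=.
case: ifP => // /andP[_]; rewrite ltr_norml => /andP[d1 d2].
case: ifP => [/andP[q1 q2]|_].
  exfalso; case: hx => -[_ q3]; case: hy => -[_ q4];
  change (sval t) with (val t) in *; change (sval t') with (val t') in *; lra.
case: ifP => [/andP[q1 q2]|_ //].
exfalso; case: hx => -[_ q3]; case: hy => -[_ q4];
change (sval t) with (val t) in *; change (sval t') with (val t') in *; lra.
Qed.

Lemma cross_seg th ep e a x y : ep < 1 / 4 ->
  seg e a (a + ep) x -> seg e a (a + ep) y ->
  cross th x y = if gpos x < th then (if th <= gpos y then [:: (e, true)] else [::])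
                 else (if th <= gpos y then [::] else [:: (e, false)]).
Proof.
case: x => [//|[e1 t]]; case: y => [//|[e2 t']] ep4 [-> /andP[a1 a2]] [-> /andP[b1 b2]].
rewrite /cross /gpos eqxx /=; change (sval t) with (val t) in *; change (sval t') with (val t') in *.
have -> : `|val t - val t'| < 1 / 2 by rewrite ltr_norml; apply/andP; split; lra.
by case: (ltP (val t) th) => ht; case: (ltP (val t') th) => ht' //=.
Qed.

(** In a star all three words are empty. In a segment a word depends only on the sides of th where
    its two points lie, and a detour through y adds a letter followed by its inverse. *)
Lemma acts_cross th ep S x y z s : ep <= th -> th <= 1 - ep -> ep < 1 / 4 ->
  small ep S -> S x -> S y -> S z -> reduced s ->
  acts (acts s (cross th x y)) (cross th y z) = acts s (cross th x z).
Proof.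
move=> h1 h2 h3 [[v Sv]|[e [a Sa]]] Sx Sy Sz rs.
  by rewrite !(cross_star h1 h2 h3 (v := v))//; exact: Sv.
rewrite !(cross_seg th (e := e) (a := a) h3); try exact: Sa.
have Kt := @actK G s (e, true) rs; have Kf := @actK G s (e, false) rs.
rewrite /orev /= in Kt Kf.
by case: (ltP (gpos x) th); case: (ltP (gpos y) th); case: (ltP (gpos z) th) => _ _ _ /=;
  rewrite ?Kt ?Kf.
Qed.

Definition row_word th (X : nat -> gspace R G) (n : nat) : seq (gedge G * bool) :=
  flatten [seq cross th (X i) (X i.+1) | i <- iota 0 n].

Lemma row_wordS th X n : row_word th X n.+1 = row_word th X n ++ cross th (X n) (X n.+1).
Proof. by rewrite /row_word -[in iota 0 n.+1]addn1 iotaD map_cat flatten_cat /= cats0 add0n. Qed.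

Lemma row_wordD th X n m :
  row_word th X (n + m) = row_word th X n ++ row_word th (fun i => X (n + i)%N) m.
Proof.
elim: m => [|m IH]; first by rewrite addn0 cats0.
by rewrite addnS !row_wordS IH catA addnS.
Qed.

Lemma row_word_mul th X n m :
  row_word th X (m * n) =
  flatten [seq row_word th (fun i => X (q * n + i)%N) n | q <- iota 0 m].
Proof.
elim: m => [|m IH]; first by rewrite mul0n.
by rewrite mulSn addnC row_wordD IH -[in iota 0 m.+1]addn1 iotaD map_cat flatten_cat /= cats0 add0n.
Qed.

Lemma eq_row_word th X Y n : (forall i, (i <= n)%N -> X i = Y i) ->
  row_word th X n = row_word th Y n.
Proof.
move=> XY; elim: n XY => // n IH XY.
by rewrite !row_wordS IH ?XY// => i ni; rewrite XY// ltnW.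
Qed.

(* The crossings along the boundary of a small cell cancel in the free group,
   hence so do those along the boundary of a grid of such cells. *)
Lemma ladder th ep (Z : nat -> nat -> gspace R G) (M : nat) :
  ep <= th -> th <= 1 - ep -> ep < 1 / 4 ->
  (forall i j, (j < M)%N -> exists S,
     [/\ small ep S, S (Z i j), S (Z i.+1 j), S (Z i j.+1) & S (Z i.+1 j.+1)]) ->
  forall n, (forall j, Z n j = Z 0%N j) -> forall s, reduced s ->
  acts (acts s (row_word th (Z^~ 0%N) n)) (row_word th (Z 0%N) M) =
  acts (acts s (row_word th (Z 0%N) M)) (row_word th (Z^~ M) n).
Proof.
move=> h1 h2 h3 cells n Zn.
(* One strip of the grid: row j followed by the step up at column k acts as the step up at column 0
   followed by row j + 1. *)
have strip j k s : (j < M)%N -> reduced s ->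
    acts (acts s (row_word th (Z^~ j) k)) (cross th (Z k j) (Z k j.+1)) =
    acts (acts s (cross th (Z 0%N j) (Z 0%N j.+1))) (row_word th (Z^~ j.+1) k).
  move=> jM rs; elim: k => // k IH; rewrite !row_wordS !acts_cat -IH.
  have [S [sS S1 S2 S3 S4]] := cells k j jM.
  by rewrite !(acts_cross h1 h2 h3 sS)//; exact: acts_reduced.
elim: M strip {cells} => // M IH strip s rs.
rewrite row_wordS !acts_cat IH//; last by move=> j k s' jM; apply: strip; rewrite ltnW.
(* By periodicity column n repeats column 0, so the same vertical step stands at both ends of the
   strip. *)
rewrite -{1}(Zn M) -{1}(Zn M.+1) strip//; exact: acts_reduced.
Qed.

End Crossings.

Section EdgeLoops.
Variables (R : realType) (G : graph).
Implicit Types (e : gedge G) (v : gvert G) (a b : gedge G * bool) (w : seq (gedge G * bool)).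

Lemma ochart0 a : ochart a (0 : R) = inl (osrc a).
Proof.
by case: a => e []; rewrite /ochart /osrc /= ?subr0; [exact: chart_le0|exact: chart_ge1].
Qed.

Lemma ochart1 a : ochart a (1 : R) = inl (otgt a).
Proof.
by case: a => e []; rewrite /ochart /otgt /= ?subrr; [exact: chart_ge1|exact: chart_le0].
Qed.

Lemma edge_loopE a w (n : int) (j : nat) (u : R) : nonbacktracking (a :: w) ->
  (j < (size w).+1)%N -> 0 <= u <= 1 ->
  edge_loop a w (n%:~R + (j%:R + u) / (size w).+1%:R) = ochart (nth a (a :: w) j) u.
Proof.
move=> nb jw u01.
apply: (@glueE1 R _ (size w).+1 (fun j => ochart (nth a (a :: w) j))) => // i iw.
rewrite ochart1 ochart0; congr inl.
by move/(cycle_nthP _ a): nb => /(_ i iw) /andP[/eqP].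
Qed.

Lemma edge_loop_frac a w (M q r : nat) : nonbacktracking (a :: w) -> (0 < M)%N ->
  (q < (size w).+1)%N -> (r <= M)%N ->
  edge_loop a w ((q * M + r)%:R / ((size w).+1 * M)%:R) =
  ochart (nth a (a :: w) q) (r%:R / M%:R : R).
Proof.
move=> nb M0 qw rM; rewrite -(@edge_loopE a w 0)//; last first.
  by rewrite divr_ge0//= ler_pdivrMr ?ltr0n// mul1r ler_nat.
congr edge_loop; rewrite add0r natrD !natrM invfM.
have M1 : M%:R != 0 :> R by rewrite pnatr_eq0 -lt0n.
have n1 : (size w).+1%:R != 0 :> R by rewrite pnatr_eq0.
move: (M%:R : R) ((size w).+1%:R : R) M1 n1 => x y x0 y0.
by field; rewrite x0 y0.
Qed.

Lemma cross_chart th e (p q : R) : `|p - q| < 1 / 2 ->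
  cross th (chart e p) (chart e q) =
  if (0 < p < 1) && (0 < q < 1) then
    if p < th <= q then [:: (e, true)] else if q < th <= p then [:: (e, false)] else [::]
  else [::].
Proof.
move=> pq; case: (boolP (0 < p < 1)) => hp; last first.
  by case: (chart_itv e p) => [|[->|->]] //=; rewrite (negbTE hp).
case: (boolP (0 < q < 1)) => hq; last first.
  rewrite (chart_in e hp) /cross.
  by case: (chart_itv e q) => [|[->|->]] //=; rewrite (negbTE hq).
by rewrite (chart_in e hp) (chart_in e hq) /cross eqxx /= pq.
Qed.

(** The sampled parameter is monotone and meets th once. The first and last samples are vertices,
    where [cross] reads nothing; as 1/M < ep, the step over th avoids them. *)
Lemma row_word_ochart th ep a (M : nat) : ep <= th -> th <= 1 - ep -> ep < 1 / 4 ->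
  (0 < M)%N -> M%:R^-1 < ep ->
  row_word th (fun r => ochart a (r%:R / M%:R : R)) M = [:: a].
Proof.
move=> h1 h2 h3 M0 Mep.
have MR : 0 < M%:R :> R by rewrite ltr0n.
have M1 : M%:R^-1 > 0 :> R by rewrite invr_gt0.
pose pos k : R := if a.2 then k%:R / M%:R else 1 - k%:R / M%:R.
pose crossed k := if a.2 then th <= pos k else pos k < th.
suff H k : (k <= M)%N ->
    row_word th (fun r => ochart a (r%:R / M%:R : R)) k = if crossed k then [:: a] else [::].
  rewrite H// /crossed /pos divff ?gt_eqF//.
  by case: (a.2); rewrite ifT//; lra.
elim: k => [_|k IH kM].
  rewrite /row_word /= /crossed /pos mul0r; case: (a.2);
  by rewrite ifF//; apply/negbTE; rewrite -?ltNge -?leNgt; lra.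
rewrite row_wordS IH ?(ltnW kM)//.
have kk : k.+1%:R / M%:R = k%:R / M%:R + M%:R^-1 :> R by rewrite -natr1 mulrDl mul1r.
have k0 : 0 <= k%:R / M%:R :> R by rewrite divr_ge0.
have k1 : k.+1%:R / M%:R <= 1 :> R by rewrite ler_pdivrMr// mul1r ler_nat.
have [->|kn0] := eqVneq k 0%N.
  rewrite mul0r ochart0 /= cats0 /crossed /pos mul0r div1r.
  by case: (a.2); rewrite !ifF//; apply/negbTE; rewrite -?ltNge -?leNgt; lra.
have [kM'|kM'] := eqVneq k.+1 M.
  have kM1 : k.+1%:R / M%:R = 1 :> R by rewrite kM' divff// gt_eqF.
  rewrite kM1 ochart1 (_ : cross _ _ _ = [::]); last by rewrite /cross; case: (ochart _ _) => // -[].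
  rewrite cats0 /crossed /pos kM1.
  by case: (a.2); rewrite !ifT//; lra.
have k0' : 0 < k%:R / M%:R :> R by rewrite divr_gt0// ltr0n lt0n.
have k1' : k.+1%:R / M%:R < 1 :> R by rewrite ltr_pdivrMr// mul1r ltr_nat ltn_neqAle kM'.
rewrite /ochart cross_chart; last first.
  by rewrite ltr_norml; case: (a.2); apply/andP; split; lra.
rewrite /crossed /pos {IH}; move: (k%:R / M%:R : R) (k.+1%:R / M%:R : R) kk k0 k1 k0' k1'.
move=> x y kk k0 k1 k0' k1'.
case: a {pos crossed} => e [] /=.
  have -> /= : (0 < x < 1) && (0 < y < 1).
    by apply/andP; split; apply/andP; split; lra.
  by case: (leP th (x)) => t1; case: (leP th (y)) => t2 //=; exfalso; lra.
have -> /= : (0 < 1 - x < 1) && (0 < 1 - y < 1).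
  by apply/andP; split; apply/andP; split; lra.
by case: (ltP (1 - x) th) => t1; case: (ltP (1 - y) th) => t2 //=; exfalso; lra.
Qed.

(** The number of samples is a multiple of the length of the word, so every vertex visited is a
    sample and the row splits edge by edge. *)
Lemma row_word_edge_loop th ep a w (M : nat) : ep <= th -> th <= 1 - ep -> ep < 1 / 4 ->
  (0 < M)%N -> M%:R^-1 < ep -> nonbacktracking (a :: w) ->
  row_word th (fun i => edge_loop a w (i%:R / ((size w).+1 * M)%:R : R)) ((size w).+1 * M) =
  a :: w.
Proof.
move=> h1 h2 h3 M0 Mep nb; rewrite row_word_mul.
have E : flatten [seq [:: nth a (a :: w) q] | q <- iota 0 (size w).+1] = a :: w.
  by rewrite (flatten_map1 (nth a (a :: w))); exact: (mkseq_nth a (a :: w)).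
rewrite -[RHS]E.
congr flatten; apply/eq_in_map => q; rewrite mem_iota /= add0n => qw.
rewrite -(row_word_ochart (nth a (a :: w) q) h1 h2 h3 M0 Mep).
by apply: eq_row_word => r rM; exact: edge_loop_frac.
Qed.

(** On an N by N grid over a homotopy, the row of Y and the row of the taut loop are conjugate by
    the side column, and so are their powers, by periodicity. The bound M0 is uniform in th and e,
    and any larger M is allowed, which leaves room for divisibility requirements on N. *)
Lemma taut_crossings (Y : R -> gspace R G) ep a w : 0 < ep -> ep < 1 / 4 ->
  nonbacktracking (a :: w) -> line_homotopic Y (edge_loop a w) ->
  exists M0, forall M, (M0 <= M)%N ->
   let N := ((size w).+1 * M)%N in
   (forall i : nat, exists S, [/\ small ep S, S (Y (i%:R / N%:R)) & S (Y (i.+1%:R / N%:R))]) /\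
   (forall th e, ep <= th -> th <= 1 - ep ->
     (ecount e (a :: w) <= ecount e (row_word th (fun i => Y (i%:R / N%:R)) N))%N).
Proof.
move=> ep0 ep4 nb [H [cH pH H0 H1]].
have ep1 : ep <= 1 by lra.
have [M1 _ hM1] := lebesgue_grid ep0 ep1 cH pH.
have [M2 _ hM2] := near_natinv_lt ep0.
exists (maxn M1 (maxn M2 1)) => M; rewrite !geq_max => /andP[M1M /andP[M2M M0]] N.
have MN : (M <= N)%N by rewrite /N mulSn leq_addr.
have N0 : (0 < N)%N by exact: leq_trans MN.
have NR : 0 < N%:R :> R by rewrite ltr0n.
have hN := hM1 N (leq_trans M1M MN).
have Mep := hM2 M M2M.
pose Z (i j : nat) : gspace R G := H (i%:R / N%:R, j%:R / N%:R).
have step (i : nat) : `|i%:R / N%:R - i%:R / N%:R| <= N%:R^-1 :> R.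
  by rewrite subrr normr0 invr_ge0 ltW.
have stepS (i : nat) : `|i%:R / N%:R - i.+1%:R / N%:R| <= N%:R^-1 :> R.
  rewrite -mulrBl -natr1 opprD addNKr mulN1r normrN ger0_norm// invr_ge0 ltW//.
have Z0 i : Z i 0%N = Y (i%:R / N%:R) by rewrite /Z mul0r H0.
have ZN i : Z i N = edge_loop a w (i%:R / N%:R) by rewrite /Z divff ?gt_eqF// H1.
have cells i j : (j < N)%N ->
    exists S, [/\ small ep S, S (Z i j), S (Z i.+1 j), S (Z i j.+1) & S (Z i.+1 j.+1)].
  move=> jN; have [|S [sS hS]] := hN (i%:R / N%:R) (j%:R / N%:R).
    by rewrite divr_ge0//= ler_pdivrMr// mul1r ler_nat ltnW.
  by exists S; split=> //; apply: hS.
split=> [i|th e h1 h2].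
  have [S [sS S1 S2 _ _]] := cells i 0%N N0; exists S.
  by rewrite -!Z0.
have per q i j : Z (q * N + i)%N j = Z i j.
  rewrite /Z natrD natrM mulrDl mulfK ?gt_eqF// addrC.
  exact: (periodic1z q (i%:R / N%:R) (pH (j%:R / N%:R))).
have pow j m : row_word th (Z^~ j) (m * N) = flatten (nseq m (row_word th (Z^~ j) N)).
  rewrite row_word_mul; elim: m => // m IH.
  rewrite -[in iota 0 m.+1]addn1 iotaD map_cat flatten_cat IH /= cats0.
  have -> : row_word th (fun i => Z ((0 + m) * N + i)%N j) N = row_word th (Z^~ j) N.
    by apply: eq_row_word => i _; rewrite per.
  by move: (row_word th (Z^~ j) N) => u; elim: m {IH} => [|m IH] /=; rewrite ?cats0// -catA IH.
have rowN : row_word th (Z^~ N) N = a :: w.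
  rewrite -[RHS](row_word_edge_loop h1 h2 ep4 M0 Mep nb).
  by apply: eq_row_word => i _; exact: ZN.
have -> : row_word th (fun i => Y (i%:R / N%:R)) N = row_word th (Z^~ 0%N) N.
  by apply: eq_row_word => i _; rewrite Z0.
rewrite -rowN; apply: (@conj_ecount G e _ _ (row_word th (Z 0%N) N)).
  move=> m s rs; rewrite -!pow.
  apply: (ladder h1 h2 ep4 cells) => // j.
  by rewrite -[(m * N)%N]addn0 per.
rewrite rowN; apply: sub_cycle nb => x y /andP[_].
by [].
Qed.

End EdgeLoops.

(** * Variation of a sampled loop in K *)

Section Variation.
Variables (R : realType) (K : graph) (l : lengths R K).
Implicit Types (e : gedge K) (x y : gspace R K) (w : seq (gedge K * bool)).

(* A globally Lipschitz substitute for the edge coordinate lval: the distance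
   to the nearest vertex has the same derivatives up to sign. *)
Definition vdist x : R := match x with
  | inl _ => 0 | inr (e, t) => elen l e * Num.min (val t) (1 - val t) end.

Definition near_on (ep : R) e x y : bool := match x, y with
  | inr (e1, t1), inr (e2, t2) => [&& e1 == e, e2 == e & `|val t1 - val t2| < ep]
  | _, _ => false end.

(** Each step of a sample is thus charged to at most one edge. *)
Lemma near_on_uniq ep e e' x y : near_on ep e x y -> near_on ep e' x y -> e = e'.
Proof.
by case: x => [//|[e1 t1]]; case: y => [//|[e2 t2]] /and3P[/eqP <- _ _] /and3P[/eqP <- _ _].
Qed.

Lemma ecount_cross th ep e x y S : ep <= th -> th <= 1 - ep -> ep < 1 / 4 ->
  small ep S -> S x -> S y ->
  (ecount e (cross th x y) <=
    near_on ep e x y && ((gpos x < th <= gpos y)%R || (gpos y < th <= gpos x)%R))%N.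
Proof.
move=> h1 h2 h3 [[v Sv]|[e0 [a Sa]]] Sx Sy.
  by rewrite (cross_star h1 h2 h3 (v := v))//; exact: Sv.
have := cross_seg th h3 (Sa _ Sx) (Sa _ Sy) => ->.
have := Sa _ Sx; have := Sa _ Sy.
case: x {Sx} => [//|[e1 t]]; case: y {Sy} => [//|[e2 t']] [-> /andP[b1 b2]] [-> /andP[a1 a2]].
rewrite /near_on /gpos; change (sval t) with (val t) in *; change (sval t') with (val t') in *.
have -> : `|val t - val t'| < ep by rewrite ltr_norml; apply/andP; split; lra.
rewrite andbT andbb; case: (ltP (val t) th) => ht; case: (ltP (val t') th) => ht' //=;
by rewrite /ecount /= ?addn0; case: (e0 == e).
Qed.

(** The function min t (1 - t) is an isometry on each half of [0, 1], where at most one of the two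
    clamps varies. A step across the fold 1/2 is shorter than ep, so both its ends lie in the gap
    between the two intervals and neither clamp varies. *)
Lemma clamp_vdist (ep t t' : R) : 0 < ep -> ep < 1 / 4 -> `|t - t'| < ep ->
  `|clamp ep (1 / 2 - ep) t' - clamp ep (1 / 2 - ep) t| +
  `|clamp (1 / 2 + ep) (1 - ep) t' - clamp (1 / 2 + ep) (1 - ep) t| <=
  `|Num.min t' (1 - t') - Num.min t (1 - t)|.
Proof.
move=> ep0 ep4; wlog tt : t t' / t <= t'.
  move=> H; have [|/ltW] := leP t t'; first exact: H.
  move=> tt d; rewrite distrC in d; have := H _ _ tt d.
  by rewrite distrC [X in _ + X <= _]distrC [X in _ <= X]distrC.
rewrite ltr_norml => /andP[d1 d2].
have [h|h] := leP t' (1 / 2).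
  have -> : Num.min t' (1 - t') = t' by apply/min_idPl; lra.
  have -> : Num.min t (1 - t) = t by apply/min_idPl; lra.
  have E u : u <= 1 / 2 -> clamp (1 / 2 + ep) (1 - ep) u = 1 / 2 + ep.
    by move=> hu; apply/max_idPl; rewrite ge_min; apply/orP; left; lra.
  rewrite !E//; last lra.
  have /andP[c1 c2] := clamp_mono_lip ep (1 / 2 - ep) tt.
  by rewrite subrr normr0 addr0 !ger0_norm//; lra.
have [h'|h'] := leP (1 / 2) t.
  have -> : Num.min t' (1 - t') = 1 - t' by apply/min_idPr; lra.
  have -> : Num.min t (1 - t) = 1 - t by apply/min_idPr; lra.
  have E u : 1 / 2 <= u -> clamp ep (1 / 2 - ep) u = 1 / 2 - ep.
    by move=> hu; rewrite /clamp (min_idPr _)?(max_idPr _)//; lra.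
  rewrite !E//; last lra.
  rewrite subrr normr0 add0r (_ : 1 - t' - (1 - t) = - (t' - t)); last by ring.
  have /andP[c1 c2] := clamp_mono_lip (1 / 2 + ep) (1 - ep) tt.
  by rewrite normrN !ger0_norm//; lra.
have E1 u : 1 / 2 - ep <= u -> clamp ep (1 / 2 - ep) u = 1 / 2 - ep.
  by move=> hu; rewrite /clamp (min_idPr _)?(max_idPr _)//; lra.
have E2 u : u <= 1 / 2 + ep -> clamp (1 / 2 + ep) (1 - ep) u = 1 / 2 + ep.
  by move=> hu; apply/max_idPl; rewrite ge_min; apply/orP; left; lra.
by rewrite !E1 ?E2 ?subrr ?normr0 ?addr0//; lra.
Qed.

Lemma near_on_vdist ep e x y : 0 < ep -> ep < 1 / 4 -> near_on ep e x y ->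
  elen l e * (`|clamp ep (1 / 2 - ep) (gpos y) - clamp ep (1 / 2 - ep) (gpos x)| +
  `|clamp (1 / 2 + ep) (1 - ep) (gpos y) - clamp (1 / 2 + ep) (1 - ep) (gpos x)|) <=
  `|vdist y - vdist x|.
Proof.
move=> ep0 ep4; case: x => [//|[e1 t]]; case: y => [//|[e2 t']] /and3P[/eqP -> /eqP -> tt].
rewrite /vdist /gpos -mulrBr normrM (ger0_norm (elen_ge0 l e)).
by apply: ler_wpM2l; [exact: elen_ge0|exact: clamp_vdist].
Qed.

(* Every th in the two intervals, of total length 1 - 4 ep, is crossed at least
   ecount e w times on the edge e. *)
Lemma taut_variation ep (X : nat -> gspace R K) (N : nat) w : 0 < ep -> ep < 1 / 4 ->
  (forall i : nat, exists S, [/\ small ep S, S (X i) & S (X i.+1)]) ->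
  (forall th e, ep <= th -> th <= 1 - ep -> (ecount e w <= ecount e (row_word th X N))%N) ->
  (1 - 4 * ep) * (\sum_(b <- w) elen l b.1) <= \sum_(i < N) `|vdist (X i.+1) - vdist (X i)|.
Proof.
move=> ep0 ep4 hS hc.
pose P e i := near_on ep e (X i) (X i.+1); pose g i := gpos (X i).
pose c1 := clamp ep (1 / 2 - ep); pose c2 := clamp (1 / 2 + ep) (1 - ep).
have cnt e th : ep <= th -> th <= 1 - ep ->
    (ecount e w <=
      \sum_(i < N | P e i) ((g i < th <= g i.+1)%R || (g i.+1 < th <= g i)%R))%N.
  move=> h1 h2; apply: (leq_trans (hc th e h1 h2)).
  rewrite big_mkcond /=; elim: N {hc} => [|n IH]; first by rewrite big_ord0.
  rewrite row_wordS /ecount count_cat -!/(ecount _ _) big_ord_recr /=.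
  apply: leq_add; first exact: IH.
  have [S [sS S1 S2]] := hS n.
  apply: (leq_trans (ecount_cross e h1 h2 ep4 sS S1 S2)).
  by rewrite /P; case: (near_on _ _ _ _).
have avg e : (1 - 4 * ep) * (ecount e w)%:R <=
    \sum_(i < N | P e i) (`|c1 (g i.+1) - c1 (g i)| + `|c2 (g i.+1) - c2 (g i)|).
  rewrite big_split /=.
  have := @average_crossings R N (ecount e w) (P e) g (fun i => g i.+1) ep (1 / 2 - ep).
  have := @average_crossings R N (ecount e w) (P e) g (fun i => g i.+1) (1 / 2 + ep) (1 - ep).
  have [q1 q2] : ep <= 1 / 2 - ep /\ 1 / 2 + ep <= 1 - ep by split; lra.
  move=> /(_ q2) A2 /(_ q1) A1.
  have B1 : (ecount e w)%:R * (1 / 2 - ep - ep) <= \sum_(i < N | P e i) `|c1 (g i.+1) - c1 (g i)|.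
    by apply: A1 => th /andP[? ?]; apply: cnt; lra.
  have B2 : (ecount e w)%:R * (1 - ep - (1 / 2 + ep)) <=
      \sum_(i < N | P e i) `|c2 (g i.+1) - c2 (g i)|.
    by apply: A2 => th /andP[? ?]; apply: cnt; lra.
  lra.
rewrite sum_word mulr_sumr.
apply: (@le_trans _ _ (\sum_e \sum_(i < N | P e i) `|vdist (X i.+1) - vdist (X i)|)).
  apply: ler_sum => e _; rewrite mulrCA.
  apply: (le_trans (ler_wpM2l (elen_ge0 l e) (avg e))); rewrite mulr_sumr.
  by apply: ler_sum => i; exact: near_on_vdist.
(* After the exchange of sums, [near_on_uniq] leaves at most one edge for each step. *)
rewrite (exchange_big_dep xpredT)//=; apply: ler_sum => i _.
have [/existsP[e Pe]|nP] := boolP [exists e, P e i]; last first.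
  rewrite big_pred0// => e; apply/negbTE; apply: contra nP => Pe.
  by apply/existsP; exists e.
rewrite (big_pred1 e)// => e'; apply/idP/eqP => [Pe'|->//].
exact: near_on_uniq Pe' Pe.
Qed.

End Variation.

(** * Distances and energy *)

Section PathDistance.
Variables (R : realType) (G : graph) (u : gedge G -> R -> R).
Implicit Types (x y z : gspace R G).

Lemma chain_cat x y z p q : chain x y p -> chain y z q -> chain x z (p ++ q).
Proof.
elim: p x => [x -> //|[[e s] t] p IH x /= [s01 t01 xe cy] cz].
by split=> //; exact: IH.
Qed.

(** Connectedness enters here: the infimum defining [gdist] runs over a nonempty set. *)
Lemma chain_exists x y : exists p, chain x y p.
Proof.
have i0 : (0 : R) \in `[0, 1] by rewrite in_itv/= lexx ler01.
have i1 : (1 : R) \in `[0, 1] by rewrite in_itv/= ler01 lexx.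
have it (t : {t : R | 0 < t < 1}) : val t \in `[0, 1].
  by have /andP[? ?] := valP t; rewrite in_itv/= !ltW.
have vv v w : exists p, chain (inl v : gspace R G) (inl w) p.
  have /connectP[p + ->] := gconnected v w.
  elim: p v => [v _|v' p IH v /= /andP[/existsP[e he] pp]]; first by exists [::].
  have [q hq] := IH v' pp.
  case/orP: he => /andP[/eqP h1 /eqP h2].
    exists ((e, 0, 1) :: q) => /=; split=> //; first by rewrite chart_le0// h1.
    by rewrite chart_ge1// h2.
  exists ((e, 1, 0) :: q) => /=; split=> //; first by rewrite chart_ge1// h2.
  by rewrite chart_le0// h1.
have xv : exists v p, chain x (inl v) p.
  case: x => [v|[e t]]; first by exists v, [::].
  exists (gsrc e), [:: (e, val t, 0)].
  by split; [exact: it|exact: i0|rewrite chart_val|exact: chart_le0].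
have vy : exists v p, chain (inl v) y p.
  case: y => [v|[e t]]; first by exists v, [::].
  exists (gsrc e), [:: (e, 0, val t)].
  by split; [exact: i0|exact: it|rewrite chart_le0|exact: chart_val].
have [v [p hp]] := xv; have [w [q hq]] := vy; have [r hr] := vv v w.
by exists (p ++ (r ++ q)); apply: chain_cat hp _; exact: chain_cat hr hq.
Qed.

Lemma chain_length_ge0 p : 0 <= chain_length u p.
Proof. by apply: sumr_ge0. Qed.

Lemma gdist_ge0 x y : 0 <= gdist u x y.
Proof.
have [p hp] := chain_exists x y.
apply: lb_le_inf; first by exists (chain_length u p), p.
by move=> _ [q _ <-]; exact: chain_length_ge0.
Qed.

Lemma gdist_chart e (s t : R) : s \in `[0, 1] -> t \in `[0, 1] ->
  gdist u (chart e s) (chart e t) <= `|u e t - u e s|.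
Proof.
move=> s01 t01; apply: ge_inf.
  by exists 0 => _ [q _ <-]; exact: chain_length_ge0.
by exists [:: (e, s, t)] => //; rewrite /chain_length big_seq1.
Qed.

Lemma gdist_lip (h : gspace R G -> R) :
  (forall e (s t : R), s \in `[0, 1] -> t \in `[0, 1] ->
     `|h (chart e t) - h (chart e s)| <= `|u e t - u e s|) ->
  forall x y, `|h y - h x| <= gdist u x y.
Proof.
move=> hh x y; have [p0 hp0] := chain_exists x y.
apply: lb_le_inf; first by exists (chain_length u p0), p0.
move=> _ [p hp <-]; elim: p x {p0 hp0} hp => [x ->|[[e s] t] p IH x /= [s01 t01 -> hp]].
  by rewrite subrr normr0 /chain_length big_nil.
rewrite /chain_length big_cons /= -/(chain_length u p).
rewrite -(subrK (h (chart e t)) (h y)) -addrA.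
apply: (le_trans (ler_normD _ _)); rewrite [leRHS]addrC.
by apply: lerD; [exact: IH|exact: hh].
Qed.

End PathDistance.

Section VertexDistance.
Variables (R : realType) (K : graph) (l : lengths R K).

Lemma vdist_chart e (t : R) : t \in `[0, 1] -> vdist l (chart e t) = elen l e * Num.min t (1 - t).
Proof.
rewrite in_itv/= => /andP[]; rewrite le_eqVlt => /predU1P[<-|t0].
  by rewrite chart_le0//= (min_idPl _) ?mulr0// subr0 ler01.
rewrite le_eqVlt => /predU1P[->|t1].
  by rewrite chart_ge1//= subrr (min_idPr _) ?mulr0// ler01.
have t01 : 0 < t < 1 by rewrite t0.
by rewrite (chart_in e t01).
Qed.

Lemma vdist_lip x y : `|vdist l y - vdist l x| <= gdist (lcoord l) x y.
Proof.
apply: gdist_lip => e s t s01 t01; rewrite !vdist_chart// /lcoord -!mulrBr !normrM.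
apply: ler_wpM2l => //; rewrite ler_norml.
have n1 := ler_norm (t - s); have := ler_norm (s - t); rewrite distrC => n2.
by case: (leP t (1 - t)) => ?; case: (leP s (1 - s)) => ?; apply/andP; split; lra.
Qed.

Lemma vdist_ge0 x : 0 <= vdist l x.
Proof.
case: x => [v|[e t]]; first exact: lexx.
apply: mulr_ge0; first exact: elen_ge0.
by have /andP[? ?] := valP t; rewrite le_min; apply/andP; split; lra.
Qed.

Lemma is_derive_max0 (h : R -> R) (s d : R) : (\forall x \near s, h x <= h s) ->
  is_derive s (1:R) h d -> d = 0.
Proof.
move=> hmax [dh dE]; apply/eqP/negPn/negP => dn0.
have hd : (fun z => z^-1 *: (h (z *: 1 + s) - h s)) @ 0^' --> d.
  by rewrite -dE; exact: dh.
have d20 : 0 < `|d| / 2 by rewrite divr_gt0// normr_gt0.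
have : \forall z \near 0^', `|d - z^-1 *: (h (z *: 1 + s) - h s)| < `|d| / 2.
  by have /cvgrPdist_lt := hd; apply.
move=> [e1 /= e10 he1].
have [e2 /= e20 he2] := hmax.
(* A step in the direction of the sign of d, within both neighbourhoods. The quotient q has the sign
   of d, whereas z * q = h (z + s) - h s is at most 0. *)
pose z := Num.sg d * (Num.min e1 e2 / 2).
have m0 : 0 < Num.min e1 e2 / 2 by rewrite divr_gt0// lt_min e10.
have zabs : `|z| = Num.min e1 e2 / 2 by rewrite normrM normr_sg dn0 mul1r gtr0_norm.
have zlt : `|z| < Num.min e1 e2 by rewrite zabs; lra.
move: zlt; rewrite lt_min => /andP[z1 z2].
have zn0 : z != 0 by rewrite -normr_gt0 zabs.
have := he1 z; rewrite /ball_ /= sub0r normrN => /(_ z1 zn0).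
have := he2 (z + s); rewrite /ball_ /= opprD addrCA subrr addr0 normrN => /(_ z2).
rewrite -[z *: 1]/(z * 1) mulr1 -[_ *: _]/(z^-1 * (h (z + s) - h s)) => hz.
set q := z^-1 * _ => hq.
have zq : z * q <= 0 by rewrite /q mulVKf// subr_le0.
have : 0 < d * q.
  have [d0|d0|d0] := ltgtP d 0; last by rewrite d0 eqxx in dn0.
    by move: hq; rewrite (ltr0_norm d0) ltr_norml => /andP[? ?]; rewrite nmulr_rgt0//; lra.
  by move: hq; rewrite (gtr0_norm d0) ltr_norml => /andP[? ?]; rewrite pmulr_rgt0//; lra.
have -> : d * q = `|d| * (z * q) / (Num.min e1 e2 / 2).
  rewrite /z {1}(numEsg d); field.
  by move: m0; case: ltgtP => // m0 _; lra.
move=> hpos; have : `|d| * (z * q) / (Num.min e1 e2 / 2) <= 0.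
  by apply: mulr_le0_ge0; [exact: mulr_ge0_le0|rewrite invr_ge0 ltW].
by rewrite leNgt hpos.
Qed.

End VertexDistance.

(** * The alpha-coordinate of an edge and its inverse *)

Section EdgeCoordinate.
Variables (R : realType) (G : graph) (al : elastic R G) (e : gedge G).
Local Notation mu := (@lebesgue_measure R).
Local Notation ec := (ecoord al e).

Let m : {measure set (measurableTypeR R) -> \bar R} := emeas al e.

Let m_sub (a b : R) : 0 <= a -> b <= 1 -> (m `[a, b]%classic < +oo)%E.
Proof.
move=> a0 b1; apply: (le_lt_trans _ (emeas_fin al e)); apply: le_measure; rewrite ?inE.
- exact: measurable_itv.
- exact: measurable_itv.
by move=> x /=; rewrite !in_itv/= => /andP[? ?]; apply/andP; split; lra.
Qed.

Lemma ecoord_lt (a b : R) : 0 <= a -> a < b -> b <= 1 -> ec a < ec b.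
Proof.
(* The midpoint keeps [c, b] disjoint from [0, a], so that their measures add up inside [0, b]. *)
move=> a0 ab b1; pose c := (a + b) / 2.
have mI (x y : R) : measurable (`[x, y]%classic : set (measurableTypeR R)).
  exact: measurable_itv.
have pos : (0 < m `[c, b]%classic)%E by apply: emeas_pos; rewrite /c; lra.
have fa : m `[0, a]%classic \is a fin_num by rewrite ge0_fin_numE// m_sub//; lra.
have fb : m `[0, b]%classic \is a fin_num by rewrite ge0_fin_numE// m_sub.
rewrite /ecoord fine_lt//.
apply: (@lt_le_trans _ _ (m `[0%R, a]%classic + m `[c, b]%classic)%E).
  by rewrite lteDl.
rewrite -measureU//.
  apply: le_measure; rewrite ?inE; [by apply: measurableU|by []|].
  by move=> x /= [|]; rewrite !in_itv/= /c => /andP[? ?]; apply/andP; split; lra.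
by apply/seteqP; split => x //= [] ; rewrite !in_itv/= /c => /andP[? ?] /andP[? ?]; lra.
Qed.

(** Absolute continuity makes the coordinate an indefinite integral; its value at 0, its continuity
    and hence its surjectivity follow. *)
Lemma ecoord_density : exists phi : R -> R, mu.-integrable `[0, 1] (EFin \o phi) /\
  forall t, 0 <= t -> t <= 1 -> ec t = \int[mu]_(x in `[0, t]) phi x.
Proof.
have mA : measurable (`[0, 1]%classic : set (measurableTypeR R)) by exact: measurable_itv.
pose N : {finite_measure set (measurableTypeR R) -> \bar R} := mfrestr mA (emeas_fin al e).
have [|p [p0 pfin pint pE]] := @radon_nikodym_sigma_finite _ _ _ mu N.
  apply/null_content_dominatesP => X mX X0.
  have /null_content_dominatesP := @emeas_abs_cont R G al e.
  move=> /(_ (X `&` `[0, 1]%classic)); apply; first exact: measurableI.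
  apply/eqP; rewrite -measure_le0 -X0; apply: le_measure; rewrite ?inE//.
  exact: measurableI.
have qp : EFin \o (fine \o p) = p by apply/funext => x /=; rewrite fineK.
exists (fine \o p); split.
  by rewrite qp; apply: (integrableS _ _ _ pint) => //; exact: measurable_itv.
move=> t t0 t1; rewrite /Rintegral; under eq_integral do rewrite -[_%:E]/((EFin \o (fine \o p)) _) qp.
rewrite -pE; last exact: measurable_itv.
change (fine (m `[0, t]%classic) = fine (m (`[0, t]%classic `&` `[0, 1]%classic))).
rewrite setIidl//.
by move=> x /=; rewrite !in_itv/= => /andP[? ?]; apply/andP; split; lra.
Qed.

Lemma ecoord0 : ec 0 = 0.
Proof.
have [phi [_ ->]] := ecoord_density; rewrite ?lexx ?ler01//.
by rewrite set_itv1 Rintegral_set1.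
Qed.

Lemma ecoord1 : ec 1 = emass al e. Proof. by []. Qed.

Lemma emass_gt0 : 0 < emass al e.
Proof. by rewrite -ecoord1 -ecoord0 ecoord_lt. Qed.

Lemma ecoord_le (a b : R) : 0 <= a -> a <= b -> b <= 1 -> ec a <= ec b.
Proof.
by move=> a0; rewrite le_eqVlt => /predU1P[->//|ab] b1; rewrite ltW// ecoord_lt.
Qed.

Lemma ecoord_itv (t : R) : 0 <= t <= 1 -> 0 <= ec t <= emass al e.
Proof. by move=> /andP[t0 t1]; rewrite -ecoord0 -ecoord1 !ecoord_le. Qed.

Lemma ecoord_surj (s : R) : 0 <= s <= emass al e -> exists t, 0 <= t <= 1 /\ ec t = s.
Proof.
move=> /andP[s0 sA]; have [phi [iphi hphi]] := ecoord_density.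
have cphi := parameterized_integral_continuous ler01 iphi.
have [|t tI tE] := IVT (v := s) ler01 cphi.
  rewrite /parameterized_integral -!hphi ?lexx ?ler01// ecoord0 ecoord1.
  by rewrite (min_idPl (ltW emass_gt0)) (max_idPr (ltW emass_gt0)) s0.
move: tI; rewrite in_itv/= => /andP[t0 t1].
by exists t; rewrite t0 t1 hphi.
Qed.

Definition eparam (s : R) : R := xget 0 [set t | t \in `[0, 1] /\ ec t = s].

Lemma eparamP (s : R) : 0 <= s <= emass al e -> 0 <= eparam s <= 1 /\ ec (eparam s) = s.
Proof.
move=> /ecoord_surj[t [t01 ts]]; rewrite /eparam; case: xgetP => [x _ [xI xs]|/(_ t) []].
  by move: xI; rewrite in_itv/=.
by rewrite /= in_itv/=.
Qed.

Lemma ecoord_inj (a b : R) : 0 <= a <= 1 -> 0 <= b <= 1 -> ec a = ec b -> a = b.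
Proof.
move=> /andP[a0 a1] /andP[b0 b1] E; case: (ltgtP a b) => // ab.
  by have := ecoord_lt a0 ab b1; rewrite E ltxx.
by have := ecoord_lt b0 ab a1; rewrite E ltxx.
Qed.

Lemma eparamK (t : R) : 0 <= t <= 1 -> eparam (ec t) = t.
Proof. by move=> t01; have [h1 h2] := eparamP (ecoord_itv t01); exact: ecoord_inj. Qed.

(** The inverse of an increasing bijection between intervals is continuous. The statement is
    confined to interior points because beyond [emass] the map [eparam] falls back to the default
    0. *)
Lemma eparam_continuous (s : R) : 0 < s < emass al e -> {for s, continuous eparam}.
Proof.
move=> /andP[s0 sA]; have sI : 0 <= s <= emass al e by rewrite !ltW.
have [/andP[t0 t1] tE] := eparamP sI.
have t0' : 0 < eparam s.
  by rewrite lt_neqAle t0 andbT; apply/eqP => t00; move: tE s0; rewrite -t00 ecoord0 => ->; rewrite ltxx.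
have t1' : eparam s < 1.
  by rewrite lt_neqAle t1 andbT; apply/eqP => t00; move: tE sA; rewrite t00 ecoord1 => ->; rewrite ltxx.
apply/cvgrPdist_le => d d0.
pose a := Num.max 0 (eparam s - d); pose b := Num.min 1 (eparam s + d).
have [a0 aT] : 0 <= a /\ a < eparam s.
  by rewrite /a le_max lexx gt_max t0' /=; split=> //; lra.
have [b1 Tb] : b <= 1 /\ eparam s < b.
  by rewrite /b ge_min lexx lt_min t1' /=; split=> //; lra.
have h1 : ec a < s by rewrite -tE ecoord_lt.
have h2 : s < ec b by rewrite -tE ecoord_lt.
near=> s'.
have g1 : ec a < s' by near: s'; exact: lt_nbhsr.
have g2 : s' < ec b by near: s'; exact: lt_nbhsl.
have s'I : 0 <= s' <= emass al e.
  have /andP[q1 _] : 0 <= ec a <= emass al e by apply: ecoord_itv; apply/andP; split; lra.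
  have /andP[_ q2] : 0 <= ec b <= emass al e by apply: ecoord_itv; apply/andP; split; lra.
  by apply/andP; split; lra.
have [/andP[u0 u1] uE] := eparamP s'I.
have k1 : a <= eparam s'.
  rewrite leNgt; apply/negP => /ltW ua.
  have : ec (eparam s') <= ec a by apply: ecoord_le => //; lra.
  by rewrite uE leNgt g1.
have k2 : eparam s' <= b.
  rewrite leNgt; apply/negP => /ltW ua.
  have : ec b <= ec (eparam s') by apply: ecoord_le => //; lra.
  by rewrite uE leNgt g2.
have a' : eparam s - d <= a by rewrite /a le_max lexx orbT.
have b' : b <= eparam s + d by rewrite /b ge_min lexx orbT.
by rewrite ler_norml; apply/andP; split; lra.
Unshelve. all: by end_near. Qed.

Lemma epointE (s : R) : epoint al e s = chart e (eparam s). Proof. by []. Qed.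

End EdgeCoordinate.

(** * Energy of a Lipschitz map on one edge *)

Section EdgeEnergy.
Variables (R : realType) (G K : graph) (al : elastic R G) (l : lengths R K).
Local Notation mu := (@lebesgue_measure R).

(** On each open half of an edge [vdist] and [lval] agree up to sign and an additive constant. At a
    vertex [vdist] has its minimum 0 and at a midpoint a local maximum, so there the derivative d is
    0. *)
Lemma speed_ge (p : R -> gspace R K) (s d : R) : {for s, continuous p} ->
  is_derive s (1:R) (vdist l \o p) d -> `|d| <= speed l p s.
Proof.
move=> cp dp; rewrite /speed; case ps : (p s) => [v|[e t]].
  have N : is_derive s (1:R) (- (vdist l \o p)) (- d) by exact: is_deriveN.
  have d0 : - d = 0.
    apply: is_derive_max0 N; near=> x.
    by rewrite /GRing.opp /= ps /= oppr0 oppr_le0 vdist_ge0.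
  by move/eqP: d0; rewrite oppr_eq0 => /eqP ->; rewrite normr0.
have nseg (a b : R) : a < val t < b -> \forall x \near s, seg e a b (p x).
  by move=> h; apply: (cp (seg e a b)); rewrite ps; exact: nbhs_seg.
have /andP[t0 t1] := valP t.
have vE x (t' : {t : R | 0 < t < 1}) : p x = inr (e, t') ->
    (vdist l \o p) x = elen l e * Num.min (val t') (1 - val t') /\
    (lval l \o p) x = elen l e * val t' by move=> E; rewrite /= E.
case: (ltgtP (val t) (1 / 2)) => ht.
- have D : is_derive s (1:R) (lval l \o p) d.
    apply: near_eq_is_derive dp; near=> x.
    have : seg e 0 (1 / 2) (p x) by near: x; apply: nseg; rewrite t0.
    case px : (p x) => [//|[e' t']] [ee /andP[a1 a2]]; rewrite ee in px.
    by have [-> ->] := vE _ _ px; rewrite (min_idPl _)//; change (sval t') with (val t') in *; lra.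
  by rewrite derive1E (@derive_val _ _ _ _ _ _ _ D).
- have D : is_derive s (1:R) (lval l \o p) (- d).
    have : is_derive s (1:R) (cst (elen l e) - (vdist l \o p)) (0 - d) by exact: is_deriveB.
    rewrite sub0r; apply: near_eq_is_derive; near=> x.
    have : seg e (1 / 2) 1 (p x) by near: x; apply: nseg; rewrite ht.
    case px : (p x) => [//|[e' t']] [ee /andP[a1 a2]]; rewrite ee in px.
    have [E1 E2] := vE _ _ px; rewrite E2.
    change (elen l e - (vdist l \o p) x = elen l e * val t'); rewrite E1.
    by rewrite (min_idPr _); [ring|change (sval t') with (val t') in *; lra].
  by rewrite derive1E (@derive_val _ _ _ _ _ _ _ D) normrN.
- have -> : d = 0; last by rewrite normr0.
  apply: is_derive_max0 dp; near=> x.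
  have : seg e 0 1 (p x) by near: x; apply: nseg; rewrite t0.
  case px : (p x) => [//|[e' t']] [ee _]; rewrite ee in px.
  have [-> _] := vE _ _ px; have [-> _] := vE _ _ ps.
  apply: ler_wpM2l; first exact: elen_ge0.
  rewrite ht; have -> : Num.min (1 / 2) (1 - 1 / 2) = 1 / 2 :> R by apply/min_idPl; lra.
  by rewrite ge_min; case: (leP (val t') (1 / 2)) => //= ?; lra.
Unshelve. all: by end_near. Qed.

(** Variation along a monotone sample is independent of the parametrization, so the sample is moved
    to the alpha-coordinate, in which f is Lipschitz and the energy is an integral. *)
Lemma edge_energy (f : gspace R G -> gspace R K) (e : gedge G) : lipschitz_map al l f ->
  exists V : R,
    (forall (t : nat -> R) n, (forall i, t i \in `[0, 1]) -> (forall i, t i <= t i.+1) ->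
       \sum_(i < n) `|vdist l (f (chart e (t i.+1))) - vdist l (f (chart e (t i)))| <= V) /\
    (forall c : R, 0 <= c -> ((2 * c * V - c ^+ 2 * emass al e)%:E <=
        \int[mu]_(s in `[0%R, emass al e]) ((speed l (f \o epoint al e) s) ^+ 2)%:E)%E).
Proof.
move=> [cf [L hL]].
have A0 := ltW (emass_gt0 al e).
(* The constant L of [glipschitz] may have any sign; |L| + 1 is a positive one. *)
have L0 : 0 < `|L| + 1 by rewrite ltr_wpDl.
pose h (s : R) := vdist l (f (epoint al e s)).
have lip (x y : R) : x \in `[0, emass al e] -> y \in `[0, emass al e] ->
    `|h x - h y| <= (`|L| + 1) * `|x - y|.
  rewrite !in_itv/= => xI yI.
  apply: (le_trans (vdist_lip l _ _)); apply: (le_trans (hL _ _)).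
  apply: (@le_trans _ _ ((`|L| + 1) * gdist (ecoord al) (epoint al e y) (epoint al e x))).
    apply: ler_wpM2r; first exact: gdist_ge0.
    by have := ler_norm L; lra.
  apply: ler_wpM2l; first exact: ltW.
  have [x01 xE] := eparamP xI; have [y01 yE] := eparamP yI.
  rewrite -{2}xE -{2}yE !epointE.
  by apply: gdist_chart; rewrite in_itv.
have sp (s d : R) : s \in `]0, emass al e[ -> is_derive s (1:R) h d ->
    `|d| <= speed l (f \o epoint al e) s.
  rewrite in_itv/= => sI; apply: (@speed_ge (f \o epoint al e)).
  apply: continuous_comp; last exact: cf.
  apply: (@continuous_comp _ _ _ (eparam al e) (chart e : R -> gspace R G)).
    exact: eparam_continuous.
  exact: chart_continuous.
have [V [hV hc]] := lipschitz_energy A0 L0 lip sp.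
exists V; split=> // t n tI tm.
have tI' i : 0 <= t i <= 1 by have := tI i; rewrite in_itv.
have := hV (fun i => ecoord al e (t i)) n; rewrite /h.
under eq_bigr do rewrite !epointE !eparamK//.
apply.
- by move=> i; rewrite in_itv/= ecoord_itv.
- by move=> i; have /andP[? ?] := tI' i; have /andP[? ?] := tI' i.+1; exact: ecoord_le.
Qed.

End EdgeEnergy.

Lemma sum_ord_mul (V : nmodType) (n P : nat) (F : nat -> V) :
  \sum_(i < n * P) F i = \sum_(q < n) \sum_(r < P) F (q * P + r)%N.
Proof.
elim: n => [|n IH]; first by rewrite mul0n !big_ord0.
rewrite big_ord_recr /= -IH mulSn addnC big_split_ord /=.
by [].
Qed.

(** * Length of the image of a curve *)

Section CurveLength.
Variables (R : realType) (G K : graph) (l : lengths R K).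
Variables (f : gspace R G -> gspace R K) (V : gedge G -> R).
Hypothesis cf : continuous f.
Hypothesis hV : forall e (t : nat -> R) n, (forall i, t i \in `[0, 1]) ->
  (forall i, t i <= t i.+1) ->
  \sum_(i < n) `|vdist l (f (chart e (t i.+1))) - vdist l (f (chart e (t i)))| <= V e.

Lemma edge_bound_ge0 e : 0 <= V e.
Proof.
have I0 (i : nat) : (fun=> 0 : R) i \in `[0, 1] by rewrite in_itv/= lexx ler01.
by have := @hV e (fun=> 0) 0 I0 (fun=> lexx _); rewrite big_ord0.
Qed.

Lemma ochart_variation (a : gedge G * bool) (P : nat) : (0 < P)%N ->
  \sum_(r < P) `|vdist l (f (ochart a (r.+1%:R / P%:R))) - vdist l (f (ochart a (r%:R / P%:R)))|
  <= V a.1.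
Proof.
move=> P0; have PR : 0 < P%:R :> R by rewrite ltr0n.
(* [hV] expects an infinite monotone sequence in [0, 1]; the minimum makes it constant from P on. *)
pose t (i : nat) : R := (minn i P)%:R / P%:R.
have tI i : t i \in `[0, 1].
  by rewrite in_itv/= divr_ge0//= ler_pdivrMr// mul1r ler_nat geq_minr.
have tm i : t i <= t i.+1.
  by rewrite ler_pM2r ?invr_gt0// ler_nat leq_min geq_minr andbT geq_min leqnSn.
apply: le_trans (hV a.1 P tI tm).
case: a => e [] /=.
  apply: ler_sum => r _; rewrite /ochart /t /=.
  by rewrite (minn_idPl (ltn_ord r)) (minn_idPl (ltnW (ltn_ord r))).
(* A reversed edge visits the same samples in the opposite order. *)
rewrite (reindex_inj rev_ord_inj) /=; apply: ler_sum => r _; rewrite /ochart /t /=.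
rewrite (minn_idPl (ltn_ord r)) (minn_idPl (ltnW (ltn_ord r))).
have E1 : 1 - (P - r.+1).+1%:R / P%:R = r%:R / P%:R :> R.
  rewrite -subSn// subSS natrB ?(ltnW (ltn_ord r))// mulrBl divff ?gt_eqF//; ring.
have E2 : 1 - (P - r.+1)%:R / P%:R = r.+1%:R / P%:R :> R.
  by rewrite natrB// mulrBl divff ?gt_eqF//; ring.
by rewrite E1 E2 distrC.
Qed.

Lemma edge_loop_variation a (w : seq (gedge G * bool)) (P : nat) : nonbacktracking (a :: w) ->
  (0 < P)%N -> let N := ((size w).+1 * P)%N in
  \sum_(i < N) `|vdist l (f (edge_loop a w (i.+1%:R / N%:R))) -
                  vdist l (f (edge_loop a w (i%:R / N%:R)))|
  <= \sum_(b <- a :: w) V b.1.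
Proof.
move=> nb P0; cbv zeta; set N := ((size w).+1 * P)%N.
pose D (i : nat) : R := vdist l (f (edge_loop a w (i%:R / N%:R))).
rewrite (@sum_ord_mul R _ P (fun i => `|D i.+1 - D i|)).
rewrite (big_nth a) big_mkord; apply: ler_sum => q _.
apply: le_trans (ochart_variation (nth a (a :: w) q) P0).
apply: ler_sum => r _; rewrite /D -addnS !edge_loop_frac//.
exact: ltnW.
Qed.

(** The image under f of the taut loop of c is homotopic to the taut loop of f o c. Its sampled
    variation is at most the right side, and at least 1 - 4 ep times the left side. *)
Lemma taut_length_le (c : R -> gspace R G) (w : seq (gedge G * bool)) b (w' : seq (gedge K * bool)) :
  taut_word c w -> taut_word (f \o c) (b :: w') ->
  \sum_(x <- b :: w') elen l x.1 <= \sum_(a <- w) V a.1.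
Proof.
move=> tw [nb' /line_homotopicP hw'].
have S0 : 0 <= \sum_(a <- w) V a.1 by apply: sumr_ge0 => a _; exact: edge_bound_ge0.
suff H ep : 0 < ep -> ep < 1 / 4 ->
    (1 - 4 * ep) * \sum_(x <- b :: w') elen l x.1 <= \sum_(a <- w) V a.1.
  set X := (\sum_(x <- _) _) in H *; set S := (\sum_(a <- _) _) in H S0 *.
  rewrite leNgt; apply/negP => SX.
  have X0 : 0 < X by apply: le_lt_trans SX.
  (* This ep turns (1 - 4 ep) X into the mean of X and S, which exceeds S if S < X. *)
  have e0 : 0 < (X - S) / (8 * X) by rewrite divr_gt0 ?subr_gt0 ?mulr_gt0.
  have e1 : (X - S) / (8 * X) < 1 / 4 by rewrite ltr_pdivrMr ?mulr_gt0//; lra.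
  have := H _ e0 e1.
  have -> : (1 - 4 * ((X - S) / (8 * X))) * X = (X + S) / 2 by field; rewrite gt_eqF.
  lra.
move=> ep0 ep4.
case: w tw S0 => [[p /line_homotopicP hp]|a w [nb /line_homotopicP hw]] S0.
  have hY : line_homotopic (f \o fun=> p) (edge_loop b w').
    apply: line_homotopic_trans hw'; apply: line_homotopic_sym.
    exact: line_homotopic_push.
  have [M0 /(_ _ (leqnn _))[hS hc]] := taut_crossings ep0 ep4 nb' hY.
  apply: (le_trans (taut_variation l ep0 ep4 hS hc)).
  by rewrite big1 ?big_nil// => i _; rewrite subrr normr0.
have hY : line_homotopic (f \o edge_loop a w) (edge_loop b w').
  apply: line_homotopic_trans hw'; apply: line_homotopic_sym.
  exact: line_homotopic_push.
have [M0 HM0] := taut_crossings ep0 ep4 nb' hY.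
(* The number of samples must be a multiple of both word lengths: that of the target for the
   crossings, that of the source for the edgewise bound on the variation. *)
pose M := ((size w).+1 * M0.+1)%N.
have [hS hc] := HM0 M (leq_trans (leqnSn M0) (leq_pmull _ (ltn0Sn _))).
apply: (le_trans (taut_variation l ep0 ep4 hS hc)).
have -> : ((size w').+1 * M = (size w).+1 * ((size w').+1 * M0.+1))%N by rewrite /M mulnCA.
by apply: edge_loop_variation => //; rewrite muln_gt0.
Qed.

Lemma curve_length_le (k : nat) (C : 'I_k -> R -> gspace R G) : is_curve C ->
  curve_length l (push_curve f C) <= \sum_e (ncross C e)%:R * V e.
Proof.
move=> hC.
have lenE (G' : graph) (D : 'I_k -> R -> gspace R G') (F : gedge G' -> R) :
    \sum_e (ncross D e)%:R * F e =
    \sum_(i < k) \sum_(b <- xget [::] [set w | taut_word (D i) w]) F b.1.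
  transitivity (\sum_e \sum_(i < k) F e *
      (count (fun a => a.1 == e) (xget [::] [set w | taut_word (D i) w]))%:R).
    by apply: eq_bigr => e _; rewrite /ncross natr_sum mulr_suml; apply: eq_bigr => i _; rewrite mulrC.
  by rewrite exchange_big; apply: eq_bigr => i _; rewrite sum_word.
rewrite /curve_length !lenE; apply: ler_sum => i _.
have [cC pC] := hC i.
(* Without a taut word the default [::] would make the i-th term on the right vanish; this is where
   existence is used. *)
have tw : taut_word (C i) (xget [::] [set w | taut_word (C i) w]).
  have [w0 hw0] := exists_taut_word cC pC.
  by case: xgetP => [w _ //|/(_ w0)]; case.
(* The empty word contributes length 0, whether it is taut or the default. *)
case E : (xget [::] [set w | taut_word (push_curve f C i) w]) => [|b w'].
  by rewrite big_nil; apply: sumr_ge0 => a _; exact: edge_bound_ge0.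
apply: (taut_length_le tw).
by move: E; case: xgetP => [w _ hw <-|].
Qed.

End CurveLength.

Theorem proposition5p12 (R : realType) (G K : graph)
    (al : elastic R G) (l : lengths R K)
    (k : nat) (C : 'I_k -> R -> gspace R G) (hC : is_curve C)
    (f : gspace R G -> gspace R K) (hf : is_harmonic al l f) :
  ((curve_length l (push_curve f C) ^+ 2)%:E
     <= DirClass al l f * (EL al C)%:E)%E.
Proof.
have [fl fmin] := hf.
have [V hV] := choice (fun e => edge_energy e fl).
have len := curve_length_le fl.1 (fun e => (hV e).1) hC.
set X := curve_length _ _ in len *; set S := (\sum_e _ * V e) in len.
have X0 : 0 <= X by apply: sumr_ge0 => e _; apply: mulr_ge0; [|exact: elen_ge0].
have XS : X ^+ 2 <= S ^+ 2 by rewrite ler_sqr// ?nnegrE// (le_trans X0).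
have D0 (g : gspace R G -> gspace R K) : (0 <= Dir al l g)%E.
  by apply: sume_ge0 => e _; apply: integral_ge0 => s _; rewrite lee_fin sqr_ge0.
(* Harmonicity: Dir f bounds from below every energy over which the infimum Dir[f] is taken. *)
have DC (y : \bar R) : (y <= Dir al l f)%E -> (y <= DirClass al l f)%E.
  move=> yD; apply: le_ereal_inf_tmp => _ [g [gl fg] <-].
  by apply: (le_trans yD); exact: fmin.
have nA0 e : 0 <= (ncross C e)%:R ^+ 2 * emass al e.
  by rewrite mulr_ge0 ?sqr_ge0// ltW// emass_gt0.
have EL0 : 0 <= EL al C by exact: sumr_ge0.
apply: (@le_trans _ _ (S ^+ 2)%:E); first by rewrite lee_fin.
(* Since every alpha(e) is positive, EL[C] = 0 forces all n_C(e) to vanish, hence S = 0. *)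
have [E0|En0] := eqVneq (EL al C) 0.
  have n0 e : (ncross C e)%:R = 0 :> R.
    have := psumr_eq0P (fun e _ => nA0 e) E0 => /(_ e isT) /eqP.
    by rewrite mulf_eq0 sqrf_eq0 (gt_eqF (emass_gt0 al e)) orbF => /eqP.
  by rewrite E0 mule0 /S big1 ?expr0n// => e _; rewrite n0 mul0r.
have EL1 : 0 < EL al C by rewrite lt_neqAle eq_sym En0.
have S0 : 0 <= S by exact: le_trans len.
(* The maximizer of 2 lam S - lam^2 EL[C], with maximum S^2 / EL[C]. *)
pose lam := S / EL al C.
have lam0 : 0 <= lam by rewrite divr_ge0.
have key : ((S ^+ 2 / EL al C)%:E <= Dir al l f)%E.
  have -> : S ^+ 2 / EL al C =
      \sum_e (2 * (lam * (ncross C e)%:R) * V e - (lam * (ncross C e)%:R) ^+ 2 * emass al e).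
    rewrite sumrB.
    have -> : \sum_e 2 * (lam * (ncross C e)%:R) * V e = 2 * lam * S.
      by rewrite /S mulr_sumr; apply: eq_bigr => e _; ring.
    have -> : \sum_e (lam * (ncross C e)%:R) ^+ 2 * emass al e = lam ^+ 2 * EL al C.
      by rewrite /EL mulr_sumr; apply: eq_bigr => e _; ring.
    by rewrite /lam; field.
  rewrite -sumEFin /Dir; apply: lee_sum => e _.
  by apply: (hV e).2; rewrite mulr_ge0.
apply: le_trans (lee_wpmul2r _ (DC _ key)); last by rewrite lee_fin.
by rewrite -EFinM divfK.
Qed.
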